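(* Let $n$ be a positive integer. If $k$ denotes the number of odd prime factors of $n$ then $$\ell(n)\le C k^2 4^k,$$ for an absolute constant $C$. Further, for each $k\ge 2$ there exist infinitely many odd integers $n$ with exactly $k$ distinct prime factors satisfying $$\ell(n)\ge 4^{\,k-Ck/\log k},$$ for some absolute constant $C$.
   Context: For a positive integer $n$, an integer $r$ is a quadratic residue mod $n$ if $r\equiv x^2 \bmod n$ for some integer $x$. The quantity $\ell(n)$ denotes the least square-free integer $r>1$ with $\gcd(r,n)=1$ such that $r$ is a quadratic residue mod $n$; equivalently, $$\ell(n)=\min\{ r\in\mathbb{N}\setminus\{1,4,9,\dots\} : r\equiv x^2 \bmod n,\ \gcd(r,n)=1\},$$ where $\{1,4,9,\dots\}$ is the set of perfect squares. The number $k$ of odd prime factors of $n$ is counted without multiplicity: $n=2^e p_1^{e_1}\cdots p_k^{e_k}$ with $p_1,\dots,p_k$ distinct odd primes, $e_j\ge 1$ and $e\ge 0$.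
   Formalization: The upper bound ℓ(n) ≤ C k² 4^k is stated for n with at least one odd prime factor (k ≥ 1); for k = 0, i.e. n a power of 2, the right side is 0 while ℓ(n) ≥ 2, so the inequality as printed fails there. *)

(* Defs.v *)
From HB Require Import structures.
From mathcomp Require Import all_boot all_order all_algebra.
From mathcomp Require Import zify ring.
From mathcomp Require Import boolp classical_sets cardinality reals exp.

Set Implicit Arguments.
Unset Strict Implicit.
Unset Printing Implicit Defensive.

Import Order.TTheory GRing.Theory Num.Theory.

Local Open Scope nat_scope.

Definition quadratic_residue (n r : nat) : Prop :=
  exists x : int, (r%:Z = (x ^+ 2)%R %[mod n%:Z])%Z.

(* 0 is not square-free in this sense. *)
Definition squarefree (r : nat) : Prop := forall d : nat, d ^ 2 %| r -> d = 1.

Definition squarefree_residue (n r : nat) : Prop :=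
  [/\ 1 < r, squarefree r, coprime r n & quadratic_residue n r].

(* The junk value 0 is taken only at n = 0, see ellP. *)
Definition ell (n : nat) : nat :=
  if pselect (exists r, `[< squarefree_residue n r >]) is left ex_r
  then ex_minn ex_r else 0.

(* Prime factors are counted without multiplicity. *)
Definition num_odd_primes (n : nat) : nat := count odd (primes n).

Lemma nonsquare_residue_squarefree (n r : nat) :
  (forall d, r <> d ^ 2) -> coprime r n -> quadratic_residue n r ->
  exists2 q, q <= r & squarefree_residue n q.
Proof.
elim/ltn_ind: r => r IH nsq cop [x rx].
have r_gt1 : 1 < r.
  by case: r nsq {IH cop rx} => [|[|r]] // h; [case: (h 0)|case: (h 1)].
have [sf|] := pselect (squarefree r); first by exists r => //; split=> //; exists x.
move=> /existsNP[d] /not_implyP[/dvdnP[q rE] d1].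
have d_gt1 : 1 < d.
  case: d d1 rE => [|[|d]] // _ rE.
  by move: r_gt1; rewrite rE muln0.
have q_gt0 : 0 < q by case: q rE r_gt1 => // ->; rewrite mul0n.
have ltqr : q < r by rewrite rE -{1}[q]muln1 ltn_pmul2l // -(exp1n 2) ltn_exp2r.
have [copq copd] : coprime q n /\ coprime d n.
  by move: cop; rewrite rE coprimeMl coprime_pexpl //; case/andP.
have [] := IH q ltqr _ copq.
- by move=> e qE; case: (nsq (e * d)); rewrite rE qE expnMn.
- have /coprimezP[[u v] /= uv] : coprimez d%:Z n%:Z by rewrite coprimezE.
  exists (u * x)%R; apply/eqP; rewrite eqz_mod_dvd.
  move/eqP: rx; rewrite eqz_mod_dvd => /dvdzP[w rx].
  have rZ : (r%:Z = q%:Z * d%:Z ^+ 2)%R by rewrite rE PoszM -[d ^ 2]/(d * d) PoszM expr2.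
  have ud : (u * d%:Z = 1 - v * n%:Z)%R by rewrite -uv addrK.
  apply/dvdzP; exists (u ^+ 2 * w + q%:Z * v * (2 - v * n%:Z))%R.
  have xE : (x ^+ 2 = r%:Z - w * n%:Z)%R by rewrite -rx subKr.
  rewrite exprMn xE rZ mulrBr mulrCA -exprMn ud.
  by rewrite expr2; ring.
- by move=> q' le_q'q sq; exists q' => //; apply: leq_trans le_q'q (ltnW ltqr).
Qed.

Lemma squarefree_residue_ex (n : nat) : 0 < n -> exists r, squarefree_residue n r.
Proof.
move=> n_gt0.
have [] := @nonsquare_residue_squarefree n (n ^ 2).+1.
- move=> d E; have : n ^ 2 < d ^ 2 by rewrite -E.
  rewrite ltn_exp2r // => lt_nd.
  have : n.+1 ^ 2 <= d ^ 2 by rewrite leq_exp2r.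
  by rewrite -E -!mulnn; lia.
- by rewrite coprime_sym -[_.+1]addn1 -[n ^ 2]/(n * n) /coprime gcdnMDl gcdn1.
- exists 1%R; apply/eqP; rewrite eqz_mod_dvd expr1n -addn1 PoszD addrK.
  by rewrite dvdzE /= dvdn_mulr.
- by move=> r _ ?; exists r.
Qed.

Lemma ellP (n : nat) : 0 < n ->
  squarefree_residue n (ell n) /\
  forall r, squarefree_residue n r -> ell n <= r.
Proof.
move=> n_gt0; rewrite /ell; case: pselect => [ex_r|[]]; last first.
  by have [r ?] := squarefree_residue_ex n_gt0; exists r; apply/asboolP.
case: ex_minnP => m /asboolP m_res m_min; split=> // r ?.
by apply: m_min; apply/asboolP.
Qed.

Lemma ell_le_nonsquare (n r : nat) : 0 < n ->
  (forall d, r <> d ^ 2) -> coprime r n -> quadratic_residue n r -> ell n <= r.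
Proof.
move=> n_gt0 nsq cop res.
have [q le_qr sq] := nonsquare_residue_squarefree nsq cop res.
exact: leq_trans ((ellP n_gt0).2 q sq) le_qr.
Qed.

(* Main.v *)
(**
Upper bound. Primes up to 2^d, 2^d of order k 2^k, outnumber the 8 2^k possible data
(quadratic character at each odd p | n, class mod 8). Two of them, a and b, share
their data, and then r = ab is a residue mod n by Hensel and the Chinese remainder theorem.

Lower bound. It is enough to attach to each prime q < 4^k a vector v_q in F_2^k such that
the sum of v_q over q | r is nonzero for every squarefree r with
1 < r < 4^(k - C k / log k), and then to find primes p_1, ..., p_k with (q/p_j) = (-1)^{v_q(j)}, so that no
such r is a residue mod n = p_1 ... p_k.
 - Vectors. Map the primes q injectively to irreducible polynomials P_q <> X over F_2 with
   2^(deg P_q) <= 64 q (there are enough of them by Chebyshev), and let v_q be the even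
   coefficients of P_q'/P_q mod X^(2k). In characteristic 2 the logarithmic derivative F of a
   product P satisfies F' = F^2, so vanishing even coefficients force F = 0 mod X^(2k),
   hence P' = 0 as soon as deg P <= 2k, which is impossible for a squarefree P. Since
   deg P <= log_2 r + 6 omega(r) and omega(r) = O(k / log k), this covers all
   r < 4^(k - C k / log k).
 - Primes. Dirichlet's theorem for products of quadratic characters gives primes p = 1 mod 4
   with prescribed (p/q), and reciprocity turns (p/q) into (q/p). For a real character chi
   Monsky's Lambert series argument gives L(1, chi) <> 0; then chi * log = chi Lambda * chi
   bounds the sums of chi(p) log p / p, while the sums of log p / p are unbounded.
*)

Require Import Defs.
From mathcomp Require Import all_boot all_order all_algebra.
From mathcomp Require Import all_fingroup all_solvable all_field.
From mathcomp Require Import zify ring lra.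
From mathcomp Require unstable.
From mathcomp Require Import boolp classical_sets cardinality reals exp.

Set Implicit Arguments.
Unset Strict Implicit.
Unset Printing Implicit Defensive.

Import Order.TTheory GRing.Theory Num.Theory.
Local Open Scope classical_set_scope.
Local Open Scope ring_scope.

(** * Chebyshev bounds *)

Section PrimeCounting.
Local Open Scope nat_scope.

Definition prime_pi n := count prime (iota 0 n.+1).

Lemma central_bin_le n : 'C(n.*2, n) <= 4 ^ n.
Proof.
rewrite -[4]/(2 ^ 2) -expnM mul2n -[X in X ^ _]/(1 + 1) expnDn.
have lt_n : n < n.*2.+1 by rewrite ltnS -addnn leq_addr.
by rewrite (bigD1 (Ordinal lt_n)) //= !exp1n !muln1 leq_addr.
Qed.

(** Induction through (2n + 1) C(2n, n) = (n + 1) C(2n + 1, n + 1) and C(2n + 2, n + 1) = 2 C(2n +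
    1, n + 1). *)
Lemma central_bin_ge n : 0 < n -> 4 ^ n <= n.*2 * 'C(n.*2, n).
Proof.
case: n => // n _; elim: n => [|n IH]; first by [].
have e1 := mul_bin_diag n.+1.*2.+1 n.+1; rewrite /= in e1.
have e3 : 'C(n.+2.*2, n.+2) = 'C(n.+1.*2.+1, n.+2) + 'C(n.+1.*2.+1, n.+1) by [].
have e4 : 'C(n.+1.*2.+1, n.+1) = 'C(n.+1.*2.+1, n.+2).
  by rewrite -bin_sub; [congr 'C(_, _)|]; lia.
rewrite e3 e4 expnS.
move: e1 IH; rewrite doubleS.
move: 'C(_, _) 'C(_, _) (4 ^ _) => x y z e1 IH; nia.
Qed.

(** A prime in (n, 2n] divides (2n)! = C(2n, n) n! n! but not n!, and distinct primes are
    coprime. *)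
Lemma prod_primes_central_bin n :
  \prod_(n.+1 <= p < n.*2.+1 | prime p) p %| 'C(n.*2, n).
Proof.
apply/unstable.Gauss_dvd_prod => [|p].
  rewrite map_id; apply/(pairwiseP 0) => i j.
  set s := filter _ _ => i_s j_s ij.
  have sP k : k < size s -> prime (nth 0 s k).
    by move/(mem_nth 0); rewrite mem_filter => /andP[].
  rewrite prime_coprime ?dvdn_prime2 ?sP // nth_uniq ?filter_uniq ?iota_uniq //.
  by rewrite neq_ltn ij.
rewrite mem_index_iota => /andP[np p2n] pp.
have pfact m : p %| m`! -> p <= m.
  elim: m => [|m IH]; first by rewrite dvdn1 => /eqP p1; rewrite p1 in pp.
  by rewrite factS Euclid_dvdM // => /orP[/dvdn_leq->//|/IH /leqW].
have := dvdn_fact (m := p) (n := n.*2).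
rewrite -(@bin_fact n.*2 n) -?addnn ?leq_addr // addnn prime_gt0 //= -ltnS p2n.
rewrite -addnn addnK => /(_ isT).
by rewrite !Euclid_dvdM // => /or3P[//| |] /pfact; rewrite leqNgt np.
Qed.

(** The primes in (2^j, 2^(j+1)] contribute at most C(2^(j+1), 2^j) <= 4^(2^j), and these bounds
    multiply up along the doubling. *)
Lemma prod_primes_le4 j : \prod_(0 <= p < (2 ^ j).+1 | prime p) p <= 4 ^ (2 ^ j).
Proof.
elim: j => [|j IH]; first by rewrite unlock.
rewrite expnSr muln2 (big_cat_nat_idem _ (n := (2 ^ j).+1)) //=; last first.
  by rewrite ltnS -addnn leq_addr.
rewrite -addnn expnD leq_mul // addnn; apply: leq_trans (central_bin_le _).
by apply: dvdn_leq (prod_primes_central_bin _); rewrite bin_gt0 -addnn leq_addr.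
Qed.

Lemma leq_exp_count_prod (T : eqType) (P : pred T) (F : T -> nat) m s :
  (forall x, x \in s -> P x -> m <= F x) -> m ^ count P s <= \prod_(x <- s | P x) F x.
Proof.
elim: s => [|x s IH] sP; first by rewrite big_nil.
rewrite big_cons /=; have {}IH : m ^ count P s <= \prod_(x <- s | P x) F x.
  by apply: IH => y ys; apply: sP; rewrite in_cons ys orbT.
case: ifP => // Px; rewrite add1n expnS leq_mul // sP ?mem_head //.
Qed.

Lemma leq_prod_exp_size (T : eqType) (F : T -> nat) m s :
  (forall x, x \in s -> F x <= m) -> \prod_(x <- s) F x <= m ^ size s.
Proof.
elim: s => [|x s IH] sP; first by rewrite big_nil.
rewrite big_cons expnS leq_mul ?sP ?mem_head // IH // => y ys.
by rewrite sP // in_cons ys orbT.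
Qed.

Lemma prime_pi_double j :
  j * count prime (iota (2 ^ j).+1 (2 ^ j)) <= 2 ^ j.+1.
Proof.
rewrite -(leq_exp2l (m := 2)) //.
have -> : 2 ^ (2 ^ j.+1) = 4 ^ (2 ^ j) by rewrite expnS mulnC expnM expnAC.
apply: leq_trans (central_bin_le _).
apply: leq_trans (dvdn_leq _ (prod_primes_central_bin (2 ^ j))); last first.
  by rewrite bin_gt0 -addnn leq_addr.
rewrite expnM /index_iota subSS -addnn addnK.
by apply: leq_exp_count_prod => p; rewrite mem_iota => /andP[/ltnW].
Qed.

(** Dyadic induction on [prime_pi_double]. The constant 6 is what makes the step close from j = 2
    on, since (6 + 2) (j + 1)/j <= 2 * 6 there. *)
Lemma prime_pi_ub j : j * prime_pi (2 ^ j) <= 6 * 2 ^ j.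
Proof.
elim: j => // -[_|[_|j IH]]; [by []|by []|].
have e : prime_pi (2 ^ j.+3) =
    prime_pi (2 ^ j.+2) + count prime (iota (2 ^ j.+2).+1 (2 ^ j.+2)).
  by rewrite /prime_pi -count_cat -iotaD addSn addnn -mul2n -expnS.
have := prime_pi_double j.+2; rewrite e !(expnS _ j.+2) (expnS _ j.+1).
by move: IH; rewrite (expnS _ j.+1); nia.
Qed.

(** Legendre's formula: each k contributes floor(2n/p^k) - 2 floor(n/p^k), which is at most 1 and is
    0 once p^k > 2n. *)
Lemma logn_central_bin p n : prime p -> 0 < n -> p ^ logn p 'C(n.*2, n) <= n.*2.
Proof.
move=> pp n_gt0; have n2 : n <= n.*2 by rewrite -addnn leq_addr.
apply: leq_trans (trunc_logP (prime_gt1 pp) (_ : 0 < n.*2)); last by rewrite double_gt0.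
rewrite leq_exp2l ?prime_gt1 //.
set b := trunc_log _ _.
have eq_log : logn p (n.*2)`! = logn p 'C(n.*2, n) + (logn p n`!).*2.
  rewrite -(bin_fact n2) -{2}addnn addnK !lognM ?muln_gt0 ?fact_gt0 ?bin_gt0 //.
  by rewrite addnn.
rewrite -(leq_add2r (logn p n`!).*2) -eq_log !logn_fact //.
have -> : \sum_(1 <= k < n.+1) n %/ p ^ k = \sum_(1 <= k < n.*2.+1) n %/ p ^ k.
  rewrite [RHS](big_cat_nat_idem _ (n := n.+1)) //= [X in _ = _ + X]big_nat_cond.
  rewrite [X in _ = _ + X]big1 ?addn0 // => k /andP[/andP[nk _] _].
  by rewrite divn_small // (leq_trans nk) // ltnW // ltn_expl // prime_gt1.
have b_le : b < n.*2.+1.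
  rewrite ltnS; apply: leq_trans (trunc_logP (prime_gt1 pp) (_ : 0 < n.*2)).
    by rewrite ltnW // ltn_expl // prime_gt1.
  by rewrite double_gt0.
have -> : b = \sum_(1 <= k < n.*2.+1) (k <= b).
  rewrite (big_cat_nat_idem _ (n := b.+1)) //= [X in _ + X]big_nat_cond.
  rewrite [X in _ + X]big1 ?addn0 => [|k]; last by rewrite andbT => /andP[/ltn_geF->].
  transitivity (\sum_(1 <= k < b.+1) 1); first by rewrite sum_nat_const_nat subn1 muln1.
  by rewrite !big_nat; apply: eq_bigr => k /andP[_]; rewrite ltnS => ->.
rewrite -[X in _ <= _ + X]mul2n big_distrr -big_split /=; apply: leq_sum => k _.
have [kb|kb] /= := leqP k b; last first.
  by rewrite divn_small // -/b (leq_trans (trunc_log_ltn _ (prime_gt1 pp))) // leq_exp2l ?prime_gt1.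
by have := leq_divDl (p ^ k) n n; rewrite addnn; lia.
Qed.

(** With 2n = 2^d, C(2n, n) >= 4^n/(2n) is a product of at most pi(2n) prime powers, each at most
    2n. *)
Lemma prime_pi_lb d : 0 < d -> 2 ^ d <= d * (prime_pi (2 ^ d)).+1.
Proof.
case: d => // d _; set n := 2 ^ d.
have n_gt0 : 0 < n by rewrite expn_gt0.
have nn : 2 ^ d.+1 = n.*2 by rewrite expnS mul2n.
rewrite -(leq_exp2l (m := 2)) // expnM.
have -> : 2 ^ 2 ^ d.+1 = 4 ^ n by rewrite expnS expnM.
apply: leq_trans (central_bin_ge n_gt0) _; rewrite nn expnS leq_mul2l; apply/orP; right.
have bin0 : 0 < 'C(n.*2, n) by rewrite bin_gt0 -addnn leq_addr.
rewrite {1}(prod_prime_decomp bin0) prime_decompE big_map /=.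
have sub : {subset primes 'C(n.*2, n) <= filter prime (iota 0 n.*2.+1)}.
  move=> p; rewrite mem_primes mem_filter mem_iota bin0 add0n /= ltnS.
  case/andP=> pp p_dvd; rewrite pp; apply: leq_trans (logn_central_bin pp n_gt0).
  by rewrite -{1}[p]expn1 leq_exp2l ?prime_gt1 // -pfactor_dvdn.
have := uniq_leq_size (primes_uniq _) sub; rewrite size_filter -/(prime_pi _).
move=> le_pi; apply: (@leq_trans (n.*2 ^ size (primes 'C(n.*2, n)))); last first.
  by rewrite leq_pexp2l ?double_gt0.
apply: leq_prod_exp_size => p.
by rewrite mem_primes => /andP[pp _]; exact: logn_central_bin.
Qed.
End PrimeCounting.

(** * Quadratic characters of finite fields and Gauss sums *)

Section QuadraticCharacter.
Variable F : finFieldType.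
Hypothesis oddF : odd #|F|.
Let h := #|F|.-1./2.

Definition qchar (a : F) : int :=
  if a == 0 then 0 else if a ^+ (#|F|.-1./2) == 1 then 1 else -1.

Lemma card_odd_field : #|F|.-1 = h.*2.
Proof.
rewrite even_halfK //; move: oddF; rewrite -(prednK (ltnW (card_finRing_gt1 F))).
by rewrite oddS.
Qed.

Lemma half_card_gt0 : (0 < h)%N.
Proof.
have := card_odd_field; have := card_finRing_gt1 F.
by rewrite lt0n; case: #|F| => [|[|n]] //= _; apply: contra_eqN => /eqP->.
Qed.

Lemma expf_double_half (a : F) : a != 0 -> a ^+ h.*2 = 1.
Proof.
move=> a0; have := expf_card a; rewrite -{1}(prednK (ltnW (card_finRing_gt1 F))).
rewrite exprS card_odd_field => aE; apply: (mulfI a0); by rewrite aE mulr1.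
Qed.

Lemma qchar0 : qchar 0 = 0. Proof. by rewrite /qchar eqxx. Qed.

Lemma qchar1 : qchar 1 = 1. Proof. by rewrite /qchar oner_eq0 expr1n eqxx. Qed.

Lemma qchar_eq0 a : (qchar a == 0) = (a == 0).
Proof. by rewrite /qchar; case: (a == 0); case: (_ == 1 :> F). Qed.

Lemma qchar_neq0 a : a != 0 -> qchar a = 1 \/ qchar a = -1.
Proof. by rewrite /qchar => /negPf->; case: (_ == 1 :> F); [left|right]. Qed.

Lemma qchar_sqr a : a != 0 -> qchar a * qchar a = 1.
Proof. by move=> /qchar_neq0[]->. Qed.

Lemma qcharE a : (qchar a)%:~R = a ^+ h.
Proof.
rewrite /qchar -/h; have [->|a0] := eqVneq a 0.
  by rewrite expr0n; have := half_card_gt0; case: h.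
case: eqP => [->//|/eqP ne1]; have := expf_double_half a0.
rewrite -muln2 exprM => /eqP; rewrite sqrf_eq1 (negPf ne1) /= => /eqP->.
by rewrite mulrN1z.
Qed.

(** X^h - 1 has at most h roots, while there are 2h nonzero elements. *)
Lemma qchar_nonresidue : exists a, qchar a = -1.
Proof.
apply: contrapT => /forallNP noN.
pose P : {poly F} := 'X^h - 1.
have P0 : P != 0 by rewrite -size_poly_eq0 size_XnsubC // half_card_gt0.
have := max_poly_roots P0 (rs := enum (predC1 (0 : F))).
rewrite enum_uniq size_XnsubC ?half_card_gt0 // -cardE cardC1 card_odd_field.
suff -> : all (root P) (enum (predC1 (0 : F))).
  by move=> /(_ isT isT); have := half_card_gt0; lia.
apply/allP => x; rewrite mem_enum inE => x0.
rewrite rootE hornerD hornerXn hornerN hornerC subr_eq0 -qcharE.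
by case: (qchar_neq0 x0) => [->//|/noN].
Qed.

Lemma odd_field_neqN1 : (-1 == 1 :> F) = false.
Proof.
have [a aN] := qchar_nonresidue; apply/negP => /eqP n11.
have := qcharE a; rewrite aN mulrN1z n11 => e.
by move: aN; rewrite /qchar -/h -e eqxx; case: (a == 0).
Qed.

(** Lets identities such as multiplicativity be checked in F, where [qchar] is a power. *)
Lemma intr_sign_inj (u v : int) :
  u \in [:: 0; 1; -1] -> v \in [:: 0; 1; -1] -> u%:~R = v%:~R :> F -> u = v.
Proof.
have n1 : (1 == -1 :> F) = false by rewrite eq_sym odd_field_neqN1.
rewrite !inE => /or3P[] /eqP-> /or3P[] /eqP-> //;
  rewrite ?mulrN1z ?mulr1z ?mulr0z => /eqP;
  by rewrite ?n1 ?odd_field_neqN1 ?[0 == _]eq_sym ?oppr_eq0 ?oner_eq0.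
Qed.

Lemma qchar_sign a : qchar a \in [:: 0; 1; -1].
Proof. by rewrite /qchar; case: (a == 0); case: (_ == 1 :> F). Qed.

Lemma qcharM : {morph qchar : a b / a * b}.
Proof.
move=> a b; apply: intr_sign_inj; rewrite ?qchar_sign //.
  have := qchar_sign a; have := qchar_sign b; rewrite !inE.
  by move=> /or3P[] /eqP-> /or3P[] /eqP->.
by rewrite intrM !qcharE exprMn.
Qed.

Lemma sum_qchar : \sum_a qchar a = 0.
Proof.
have [b bN] := qchar_nonresidue.
have b0 : b != 0 by rewrite -qchar_eq0 bN.
suff : \sum_a qchar a = - \sum_a qchar a by lia.
rewrite {1}(reindex_inj (mulfI b0)) /= -sumrN; apply: eq_bigr => a _.
by rewrite qcharM bN mulN1r.
Qed.

(** In the cyclic unit group of order 2h write a = g^m; a^h = 1 forces 2h to divide m h, so m is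
    even. *)
Lemma qchar1_square a : qchar a = 1 -> exists x, a = x ^+ 2.
Proof.
move=> a1; have a0 : a != 0 by rewrite -qchar_eq0 a1.
have /cyclicP[/= g gE] := field_unit_group_cyclic [set: {unit F}]%SET.
have ua : a \is a GRing.unit by rewrite unitfE.
have : FinRing.unit F ua \in <[g]>%g by rewrite -gE inE.
move=> /cycleP[m aE].
have := order_dvdn g (m * h); rewrite expgM -aE orderE -gE card_finField_unit card_odd_field.
have -> : (FinRing.unit F ua ^+ h == 1)%g.
  by apply/eqP/val_inj; rewrite FinRing.val_unitX /= -qcharE a1.
rewrite -muln2 mulnC dvdn_pmul2r ?half_card_gt0 // => /dvdnP[j mE].
exists (val g ^+ j); rewrite -exprM -mE -FinRing.val_unitX -aE.
by [].
Qed.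

End QuadraticCharacter.

(** * Quadratic Gauss sums in an arbitrary field *)

Section GaussSum.
Variables (q : nat) (L : fieldType) (z : L).
Hypotheses (q_pr : prime q) (q_odd : odd q) (zq : z ^+ q = 1) (z1 : z != 1).

Let card_Fq_odd : odd #|'F_q|. Proof. by rewrite card_Fp. Qed.

Definition add_char (a : 'F_q) : L := z ^+ a.

Lemma add_charD a b : add_char (a + b) = add_char a * add_char b.
Proof.
by rewrite /add_char -exprD /= [in X in (_ %% X)%N]Fp_cast // expr_mod.
Qed.

Lemma add_charMn a n : add_char (a * n%:R) = add_char a ^+ n.
Proof.
elim: n => [|n IH]; first by rewrite mulr0.
by rewrite mulrS mulrDr mulr1 add_charD IH exprS.
Qed.

Lemma sum_add_char : \sum_a add_char a = 0.
Proof.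
have : add_char 1 * \sum_a add_char a = \sum_a add_char a.
  rewrite mulr_sumr [RHS](reindex_inj (addrI 1)) /=.
  by apply: eq_bigr => a _; rewrite add_charD.
move=> /eqP; rewrite -subr_eq0 -{2}[\sum_a _]mul1r -mulrBl mulf_eq0 subr_eq0.
have -> : add_char 1 = z by rewrite /add_char -[RHS]expr1.
by rewrite (negPf z1) => /eqP.
Qed.

Lemma sum_add_char_mul c : \sum_a add_char (a * c) = if c == 0 then q%:R else 0.
Proof.
case: eqP => [->|/eqP c0].
  under eq_bigr do rewrite mulr0 /add_char expr0.
  by rewrite sumr_const card_Fp.
rewrite -[RHS]sum_add_char (reindex_inj (mulIf (invr_neq0 c0))) /=.
by apply: eq_bigr => a _; rewrite mulfVK.
Qed.

Definition gauss_sum : L := \sum_(a : 'F_q) (qchar a)%:~R * add_char a.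

(** The substitution b = a c turns the square into a sum over c of (c/q) times the sum over a <> 0
    of [add_char (a * (1 + c))], which is q - 1 at c = -1 and -1 elsewhere; the symbols (c/q) sum to
    0. *)
Lemma gauss_sum_sqr : gauss_sum ^+ 2 = (qchar (-1 : 'F_q))%:~R * q%:R.
Proof.
transitivity (\sum_(a : 'F_q | a != 0) \sum_(c : 'F_q) (qchar c)%:~R * add_char (a * (1 + c))).
  rewrite expr2 {1}/gauss_sum mulr_suml (bigD1 0) //= qchar0 mulr0z mul0r mul0r add0r.
  apply: eq_bigr => a a0; rewrite /gauss_sum mulr_sumr (reindex_inj (mulfI a0)) /=.
  apply: eq_bigr => c _; rewrite qcharM // mulrDr mulr1 add_charD intrM.
  have : (qchar a)%:~R * (qchar a)%:~R = 1 :> L by rewrite -intrM qchar_sqr.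
  by move: (qchar a)%:~R => x xx; ring: xx.
rewrite exchange_big /= (bigID (pred1 (-1))) /= big_pred1_eq.
have inner c : \sum_(a : 'F_q | a != 0) (qchar c)%:~R * add_char (a * (1 + c)) =
   (qchar c)%:~R * ((if c == -1 then q%:R else 0) - 1).
  rewrite -mulr_sumr; congr (_ * _).
  have := sum_add_char_mul (1 + c); rewrite addrC addr_eq0 (bigD1 0) //= mul0r => <-.
  by rewrite /add_char expr0 [1 + _]addrC addrK addrC.
rewrite inner eqxx.
under eq_bigr => c cN do rewrite inner (negPf cN) sub0r mulrN1.
have := sum_qchar card_Fq_odd; rewrite (bigD1 (-1)) //=.
move=> /(congr1 (fun x => x%:~R : L)); rewrite intrD rmorph_sum /= mulr0z sumrN => e.
by rewrite mulrBr mulr1 -addrA -opprD e oppr0 addr0.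
Qed.

(** The p-th power is additive in characteristic p and sends the character at a to its value at p a;
    reindexing brings out (p/q), and signs are fixed because p is odd. *)
Lemma gauss_sum_Frobenius p : prime p -> odd p -> p != q -> p \in [pchar L] ->
  gauss_sum ^+ p = (qchar (p%:R : 'F_q))%:~R * gauss_sum.
Proof.
move=> p_pr p_odd neq_pq pcharL.
have pq0 : p%:R != 0 :> 'F_q.
  by rewrite -(dvdn_pcharf (pchar_Fp q_pr)) dvdn_prime2 // eq_sym.
rewrite -(pFrobenius_autE pcharL) /gauss_sum rmorph_sum mulr_sumr /=.
rewrite [RHS](reindex_inj (mulIf pq0)) /=; apply: eq_bigr => a _.
rewrite pFrobenius_autE exprMn add_charMn mulrA; congr (_ * _).
rewrite -rmorphXn -intrM /= qcharM // mulrCA qchar_sqr // mulr1; congr (_%:~R).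
have := qchar_sign a; rewrite !inE => /or3P[] /eqP->.
- by rewrite expr0n; case: p p_odd {p_pr neq_pq pcharL pq0}.
- by rewrite expr1n.
- by rewrite -signr_odd p_odd.
Qed.

End GaussSum.

(** * Quadratic reciprocity *)

Definition legendre (p a : nat) : int := qchar (a%:R : 'F_p).

Section Legendre.
Variable p : nat.
Hypotheses (p_pr : prime p) (p_odd : odd p).

Let card_Fp_odd : odd #|'F_p|. Proof. by rewrite card_Fp. Qed.

Lemma legendre_eq0 a : (legendre p a == 0) = (p %| a)%N.
Proof. by rewrite /legendre qchar_eq0 -(dvdn_pcharf (pchar_Fp p_pr)). Qed.

Lemma legendre1 : legendre p 1 = 1.
Proof. exact: qchar1. Qed.

Lemma legendreM a b : legendre p (a * b) = legendre p a * legendre p b.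
Proof. by rewrite /legendre natrM qcharM. Qed.

Lemma legendre_mod a : legendre p (a %% p) = legendre p a.
Proof. by rewrite /legendre Fp_nat_mod. Qed.

Lemma legendre_nonresidue : exists a, legendre p a = -1.
Proof.
have [a aN] := qchar_nonresidue card_Fp_odd.
by exists a; rewrite /legendre natr_Zp.
Qed.

Lemma legendre_residue (n a : nat) : (p %| n)%N -> coprime a n ->
  quadratic_residue n a -> legendre p a = 1.
Proof.
move=> p_n cop [x /eqP]; rewrite eqz_mod_dvd => ax.
have pa : (p %| a)%N = false.
  apply/negP => pa; have : (p %| gcdn a n)%N by rewrite dvdn_gcd pa.
  by rewrite (eqP cop) dvdn1 => /eqP p1; move: p_pr; rewrite p1.
have aE : a%:R = (x%:~R : 'F_p) ^+ 2.
  apply/eqP; rewrite -subr_eq0 -rmorphXn -[a%:R]/((a%:Z)%:~R) -intrB.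
  have /dvdzP[y ->] : (p%:Z %| a%:Z - x ^+ 2)%Z by apply: dvdz_trans ax.
  by rewrite intrM -pmulrn (eqP (_ : p%:R == 0 :> 'F_p)) ?mulr0 // -(dvdn_pcharf (pchar_Fp p_pr)).
have x0 : x%:~R != 0 :> 'F_p.
  by apply/eqP => x0; move: pa; rewrite -legendre_eq0 /legendre aE x0 expr0n qchar0 eqxx.
by rewrite /legendre aE expr2 qcharM // qchar_sqr.
Qed.

End Legendre.

Lemma natr_eq1_pchar (L : fieldType) p m : p \in [pchar L] -> (0 < m)%N ->
  (m%:R == 1 :> L) = (p %| m.-1)%N.
Proof.
by move=> pcharL m_gt0; rewrite (dvdn_pcharf pcharL) -subn1 natrB // subr_eq0.
Qed.

Lemma modn4_odd p : (p %% 4 = 1)%N -> odd p.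
Proof. by move=> p4; rewrite (divn_eq p 4) p4 oddD oddM andbF. Qed.

(* Compare gauss_sum^p = (p/q) gauss_sum with gauss_sum^2 = (-1/q) q in a field of
   characteristic p containing a primitive q-th root of unity. *)
Lemma quadratic_reciprocity1 p q : prime p -> prime q -> odd q -> p != q ->
  (p %% 4 = 1)%N -> legendre p q = legendre q p.
Proof.
move=> p_pr q_pr q_odd neq_pq p4; have p_odd := modn4_odd p4.
have [h2 ph] : exists h2, p = (h2.*2.*2).+1.
  by exists (p %/ 4)%N; rewrite {1}(divn_eq p 4) p4 addn1 -!muln2 -mulnA.
have q1_gt0 : (0 < q.-1)%N by rewrite -subn1 subn_gt0 prime_gt1.
have [L pcharL cardL] := pPrimePowerField p_pr q1_gt0.
have oddL : odd #|L| by rewrite cardL oddX p_odd orbT.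
have qL0 : q%:R != 0 :> L by rewrite -(dvdn_pcharf pcharL) dvdn_prime2.
(* By Fermat p^(q-1) = 1 mod q, so q divides the order of the unit group of the field with p^(q-1)
   elements, and Cauchy gives an element of order q. *)
have q_dvd : (q %| #|[set: {unit L}]%SET|)%N.
  have pFq0 : p%:R != 0 :> 'F_q.
    by rewrite -(dvdn_pcharf (pchar_Fp q_pr)) dvdn_prime2 // eq_sym.
  rewrite card_finField_unit cardL -(natr_eq1_pchar (pchar_Fp q_pr)) ?expn_gt0 ?prime_gt0 //.
  have := expf_card (p%:R : 'F_q); rewrite card_Fp // natrX => e.
  apply/eqP/(mulfI pFq0); rewrite -exprS mulr1 -[RHS]e.
  by rewrite (prednK (prime_gt0 q_pr)).
have [u _ ord_u] := Cauchy q_pr q_dvd.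
pose z : L := val u.
have zq : z ^+ q = 1 by rewrite -FinRing.val_unitX -ord_u expg_order.
have z1 : z != 1.
  apply/eqP => z1; have u1 : u = 1%g by apply: val_inj.
  by move: ord_u q_pr; rewrite u1 order1 => <-.
pose g := gauss_sum q z.
have g2 : g ^+ 2 = (qchar (-1 : 'F_q))%:~R * q%:R by exact: gauss_sum_sqr.
have N1 : (-1 : 'F_q) != 0 by rewrite oppr_eq0 oner_eq0.
have g0 : g != 0.
  apply: contraNneq qL0 => g0; move: g2; rewrite g0 expr0n /= => /esym/eqP.
  by rewrite mulf_eq0; case: (qchar_neq0 N1) => ->; rewrite ?mulrN1z ?oppr_eq0 oner_eq0.
have gp : g ^+ p = (legendre q p)%:~R * g by exact: gauss_sum_Frobenius.
(* (p - 1)/2 is even, so the sign (-1/q) in the square of the Gauss sum disappears. *)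
have key : (q ^ (p.-1)./2)%:R = (legendre q p)%:~R :> L.
  apply: (mulIf g0); rewrite -gp ph /= doubleK exprS mulrC -[h2.*2.*2]mul2n exprM g2.
  rewrite natrX exprMn -[in X in X * _ ^+ _]mul2n exprM.
  by case: (qchar_neq0 N1) => ->; rewrite ?mulrN1z ?sqrrN expr1n ?expr1n mul1r.
have q_h : (0 < q ^ (p.-1)./2)%N by rewrite expn_gt0 prime_gt0.
(* Both symbols are signs, and each equals 1 exactly when p divides q^((p-1)/2) - 1. *)
have := natr_eq1_pchar pcharL q_h; rewrite -(natr_eq1_pchar (pchar_Fp p_pr)) // key.
have p_q0 : p%:R != 0 :> 'F_q.
  by rewrite -(dvdn_pcharf (pchar_Fp q_pr)) dvdn_prime2 // eq_sym.
have q_p0 : q%:R != 0 :> 'F_p by rewrite -(dvdn_pcharf (pchar_Fp p_pr)) dvdn_prime2.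
have -> : legendre p q = if (q%:R : 'F_p) ^+ (p.-1)./2 == 1 then 1 else -1.
  by rewrite /legendre /qchar card_Fp // (negPf q_p0).
rewrite natrX.
case: (qchar_neq0 p_q0); rewrite /legendre => ->.
  by rewrite eqxx => <-.
by rewrite mulrN1z odd_field_neqN1 // => <-.
Qed.

(* With i^2 = -1 in F_p, (1 + i)^2 = 2 i, so 2^((p-1)/2) i^((p-1)/2) = 1. *)
Lemma legendre2 p : prime p -> (p %% 4 = 1)%N ->
  legendre p 2 = if (p %% 8 == 1)%N then 1 else -1.
Proof.
move=> p_pr p4; have p_odd := modn4_odd p4.
have oddF : odd #|'F_p| by rewrite card_Fp.
have [m ph] : exists m, p = (m.*2.*2).+1.
  by exists (p %/ 4)%N; rewrite {1}(divn_eq p 4) p4 addn1 -!muln2 -mulnA.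
have half_p : p.-1./2 = m.*2 by rewrite ph /= doubleK.
(* For a nonresidue a, i = a^((p-1)/4) has i^2 = -1. Then i^((p-1)/2) = (-1)^((p-1)/4), which is 1
   exactly when p = 1 mod 8. *)
have [a aN] := qchar_nonresidue oddF.
have := qcharE oddF a; rewrite aN card_Fp // half_p mulrN1z -mul2n mulnC exprM.
set i := a ^+ m => /esym i2.
have h2 : (2%:R : 'F_p) != 0.
  rewrite -(dvdn_pcharf (pchar_Fp p_pr)) dvdn_prime2 //.
  by apply: contraL p_odd => /eqP->.
have i1 : (1 + i) ^+ 2 = 2%:R * i by ring: i2.
have i10 : 1 + i != 0.
  by apply: contraNneq h2 => i10; apply/eqP; have : (1 + i) * (1 - i) = 2%:R;
     [ring: i2|rewrite i10 mul0r].
have := expf_double_half oddF i10.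
rewrite card_Fp // half_p -mul2n exprM i1 exprMn -[m.*2]mul2n [in i ^+ _]exprM i2.
have : legendre p 2 = 1 \/ legendre p 2 = -1 by exact: qchar_neq0.
have : (legendre p 2)%:~R = 2%:R ^+ (2 * m) :> 'F_p.
  by rewrite /legendre qcharE // card_Fp // half_p mul2n.
have -> : (p %% 8 == 1)%N = ~~ odd m by rewrite ph; lia.
rewrite -signr_odd => <-.
have := odd_field_neqN1 oddF.
by case: odd => nN [] -> /eqP; rewrite ?mulrN1z ?mulrNN ?mulr1 ?mul1r ?expr0 ?expr1 ?nN.
Qed.

(** * Nonvanishing of L(1, chi) for real characters *)

Section Abel.
Variable R : realType.
Implicit Types (u a : nat -> R).

(** With S the partial sums of u, the sum is S(N) a(N) plus the sum of S(i+1) (a(i) - a(i+1)); the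
    weights are nonnegative and add up to a(m). *)
Lemma abel_bound u a (B : R) m N :
  (forall n, `|\sum_(m <= i < n) u i| <= B) ->
  (forall i, (m <= i)%N -> 0 <= a i.+1 <= a i) ->
  `|\sum_(m <= i < N) u i * a i| <= B * a m.
Proof.
move=> uB aD.
have a_ge0 i : (m <= i)%N -> 0 <= a i by move=> /aD /andP[]; apply: le_trans.
have B_ge0 : 0 <= B by apply: le_trans (uB m).
case: (leqP N m) => [Nm|/ltnW mN]; first by rewrite big_geq // normr0 mulr_ge0 ?a_ge0.
pose S n := \sum_(m <= i < n) u i.
have -> : \sum_(m <= i < N) u i * a i =
    S N * a N + \sum_(m <= i < N) S i.+1 * (a i - a i.+1).
  rewrite -(subnKC mN); elim: (N - m)%N => [|d IH].
    by rewrite addn0 /S !big_geq ?mul0r ?addr0.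
  rewrite addnS !big_nat_recr ?leq_addr //= IH /S big_nat_recr ?leq_addr //=.
  by ring.
apply: le_trans (ler_normD _ _) _.
have -> : B * a m = B * a N + \sum_(m <= i < N) B * (a i - a i.+1).
  rewrite -mulr_sumr -mulrDr; congr (_ * _).
  under eq_bigr do rewrite -opprB.
  by rewrite sumrN telescope_sumr //; ring.
rewrite lerD //; first by rewrite normrM (ger0_norm (a_ge0 _ mN)) ler_wpM2r ?a_ge0 ?uB.
apply: le_trans (ler_norm_sum _ _ _) _.
rewrite big_nat [leRHS]big_nat; apply: ler_sum => i /andP[mi _].
have /andP[_ ai] := aD _ mi.
by rewrite normrM (ger0_norm (_ : 0 <= a i - _)) ?subr_ge0 // ler_wpM2r ?subr_ge0 ?uB.
Qed.

Lemma sum_multiples (F : nat -> R) d N : (0 < d)%N ->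
  \sum_(1 <= n < N.+1 | (d %| n)%N) F n = \sum_(1 <= j < (N %/ d).+1) F (d * j)%N.
Proof.
move=> d_gt0; elim: N => [|N IH]; first by rewrite div0n !big_geq.
rewrite big_mkcond big_nat_recr //= -big_mkcond IH divnS //.
case: ifP => [dN|_]; last by rewrite addr0.
have dN1 : (d * (N %/ d).+1 = N.+1)%N by rewrite -[RHS](divnK dN) divnS // dN mulnC.
by rewrite add1n [RHS]big_nat_recr //= dN1.
Qed.

Lemma sum_nat_subset (F : nat -> R) (P : pred nat) m n :
  (forall i, 0 <= F i) -> \sum_(m <= i < n | P i) F i <= \sum_(m <= i < n) F i.
Proof.
move=> F0; rewrite big_mkcond; apply: ler_sum => i _; case: ifP => // _.
Qed.

Lemma ler_sum_nat_widen (F : nat -> R) m n1 n2 : (n1 <= n2)%N ->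
  (forall i, 0 <= F i) -> \sum_(m <= i < n1) F i <= \sum_(m <= i < n2) F i.
Proof.
move=> n12 F0; case: (leqP m n1) => [mn|/ltnW mn]; last by rewrite big_geq // sumr_ge0.
by rewrite [leRHS](big_cat_nat (n := n1)) //= lerDl sumr_ge0.
Qed.
End Abel.

(** * Inequalities for geometric sums *)

Section Geometric.
Variables (R : realType) (t : R).
Hypothesis (t01 : 0 <= t <= 1).

(** The quotient (1 - t^n)/(1 - t), written as a sum so that it makes sense at t = 1. *)
Definition geosum n : R := \sum_(i < n) t ^+ i.

Let t0 : 0 <= t. Proof. by case/andP: t01. Qed.
Let t1 : t <= 1. Proof. by case/andP: t01. Qed.

Lemma geosumE n : (1 - t) * geosum n = 1 - t ^+ n.
Proof. by rewrite /geosum -[in RHS](expr1n _ n) subrXX; congr (_ * _); apply: eq_bigr => i _; rewrite expr1n mul1r. Qed.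

Lemma geosum_ge1 n : (0 < n)%N -> 1 <= geosum n.
Proof.
by case: n => // n _; rewrite /geosum big_ord_recl expr0 lerDl sumr_ge0 // => i _; rewrite exprn_ge0.
Qed.

Lemma geosum_ge n : n%:R * t ^+ n <= geosum n.
Proof.
rewrite /geosum mulrC mulr_natr -[X in _ *+ X]card_ord -sumr_const; apply: ler_sum => i _.
by rewrite ler_wiXn2l // ltnW.
Qed.

(* Pairing t^e with t^(2n-1-e) in the expanded product replaces the square roots of AM-GM. *)
Lemma geosum_mul_ge n : n%:R * n.+1%:R * t ^+ n <= geosum n * geosum n.+1.
Proof.
have rev m : geosum m = \sum_(i < m) t ^+ (m.-1 - i).
  rewrite /geosum (reindex_inj rev_ord_inj) /=; apply: eq_bigr => i _.
  by congr (_ ^+ _); case: m i => [[]//|m] i /=; rewrite subSS.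
have dbl : geosum n * geosum n.+1 = \sum_(i < n) \sum_(j < n.+1) t ^+ (i + j).
  by rewrite mulr_suml; apply: eq_bigr => i _; rewrite mulr_sumr; apply: eq_bigr => j _; rewrite exprD.
have dbl2 : geosum n * geosum n.+1 = \sum_(i < n) \sum_(j < n.+1) t ^+ ((n + n).-1 - (i + j)).
  rewrite !rev mulr_suml; apply: eq_bigr => i _; rewrite mulr_sumr; apply: eq_bigr => j _.
  rewrite -exprD; congr (_ ^+ _); have := ltn_ord i; have := ltn_ord j; rewrite /=; lia.
rewrite -(ler_pM2l (_ : 0 < 2)) // [leRHS]mulrDl mul1r {1}dbl dbl2 -big_split /=.
rewrite (eq_bigr (fun i : 'I_n => \sum_(j < n.+1) (t ^+ (i + j) + t ^+ ((n + n).-1 - (i + j))))); last first.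
  by move=> i _; rewrite big_split.
(* With t^e factored out, it remains to see 2x <= 1 + y for x = t^(f+1) and y = t^(2f+1) >= x^2. *)
have pair e e' : (e <= e')%N -> (e + e' = (n + n).-1)%N -> 2 * t ^+ n <= t ^+ e + t ^+ e'.
  case: n {rev dbl dbl2} => [|n] le_e.
    case: e le_e => [|e] le_e e0; last by lia.
    by rewrite (_ : e' = 0)%N ?expr0; [lra|lia].
  move=> e_sum; have [f fE] : exists f, (n = e + f)%N by exists (n - e)%N; lia.
  have -> : (e' = e + (f + f).+1)%N by lia.
  rewrite fE -addnS !exprD.
  have te : 0 <= t ^+ e by rewrite exprn_ge0.
  have tf : 0 <= t ^+ f.+1 by rewrite exprn_ge0.
  rewrite mulrCA -[X in X + _]mulr1 -mulrDr ler_wpM2l //.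
  have : t ^+ f.+1 * t ^+ f.+1 <= t ^+ (f + f).+1.
    by rewrite -exprD ler_wiXn2l // addnS addSn.
  move: (t ^+ f.+1) (t ^+ (f + f).+1) => x y xy.
  by have := sqr_ge0 (x - 1); rewrite expr2; nra.
have -> : 2 * (n%:R * n.+1%:R * t ^+ n) = \sum_(i < n) \sum_(j < n.+1) 2 * t ^+ n.
  by rewrite !sumr_const !card_ord -[RHS]mulr_natr -[_ *+ n.+1]mulr_natr; ring.
apply: ler_sum => i _; apply: ler_sum => j _.
have := ltn_ord i; have := ltn_ord j => jn ij.
case: (leqP (i + j) ((n + n).-1 - (i + j))) => le_e; first by apply: pair => //; lia.
by rewrite addrC; apply: pair; lia.
Qed.

End Geometric.

(** * Divisor sums of a real character *)

Section DivisorSum.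
Variables (R : realType) (chi : nat -> R).
Hypotheses (chi1 : chi 1 = 1) (chiM : forall m n, chi (m * n) = chi m * chi n).
Hypothesis chi_sign : forall n, chi n \in [:: 0; 1; -1].

Lemma chiX m n : chi (m ^ n) = chi m ^+ n.
Proof. by elim: n => [|n IH]; rewrite ?expn0 // expnS chiM IH exprS. Qed.

Lemma chi_norm n : `|chi n| <= 1.
Proof.
by have := chi_sign n; rewrite !inE => /or3P[] /eqP->; rewrite ?normr0 ?normrN ?normr1.
Qed.

(** The coefficients of zeta(s) L(s, chi). *)
Definition divisor_sum n := \sum_(d <- divisors n) chi d.

(** Splits the divisors by whether p occurs in them with the full exponent a + 1; this drives the
    induction for [divisor_sum_pfactor]. *)
Lemma divisors_pfactorS p a m : prime p -> (0 < m)%N -> ~~ (p %| m)%N ->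
  perm_eq (divisors (p ^ a.+1 * m))
    (divisors (p ^ a * m) ++ map (muln (p ^ a.+1)) (divisors m)).
Proof.
move=> p_pr m_gt0 p_m.
have p_gt0 := prime_gt0 p_pr.
have pm : coprime p m by rewrite prime_coprime.
apply: uniq_perm; first exact: divisors_uniq.
  rewrite cat_uniq divisors_uniq map_inj_uniq ?divisors_uniq /=; last first.
    by move=> x y /eqP; rewrite eqn_pmul2l ?expn_gt0 ?p_gt0 // => /eqP.
  rewrite andbT; apply/hasPn => _ /mapP[d d_m ->].
  rewrite -dvdn_divisors ?muln_gt0 ?expn_gt0 ?p_gt0 //; apply/negP => /(dvdn_trans (dvdn_mulr _ (dvdnn _))).
  by rewrite expnSr dvdn_pmul2l ?expn_gt0 ?p_gt0 // (negPf p_m).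
move=> d; rewrite mem_cat -!dvdn_divisors ?muln_gt0 ?expn_gt0 ?p_gt0 //.
apply/idP/orP => [d_dvd|[d_dvd|/mapP[e]]]; last 2 first.
- by apply: dvdn_trans d_dvd _; rewrite expnS -mulnA dvdn_mull.
- by rewrite -dvdn_divisors // => e_m ->; rewrite dvdn_mul.
have d_gt0 : (0 < d)%N by apply: dvdn_gt0 d_dvd; rewrite muln_gt0 expn_gt0 p_gt0.
have [e cop_pe dE] := pfactor_coprime p_pr d_gt0.
have e_m : (e %| m)%N.
  have : (e %| p ^ a.+1 * m)%N by apply: dvdn_trans d_dvd; rewrite dE dvdn_mulr.
  by rewrite Gauss_dvdr // coprime_sym coprime_pexpl.
have le_a : (logn p d <= a.+1)%N.
  have := dvdn_leq_log p (_ : (0 < p ^ a.+1 * m)%N) d_dvd.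
  rewrite muln_gt0 expn_gt0 p_gt0 m_gt0 /= lognM ?expn_gt0 ?p_gt0 // pfactorK //.
  by rewrite (logn_coprime pm) addn0; apply.
move: le_a; rewrite leq_eqVlt => /orP[/eqP l_a|].
  right; apply/mapP; exists e; first by rewrite -dvdn_divisors.
  by rewrite dE l_a mulnC.
rewrite ltnS => l_a; left; rewrite dE mulnC dvdn_mul // dvdn_exp2l //.
Qed.

Lemma divisor_sum_pfactor p a m : prime p -> (0 < m)%N -> ~~ (p %| m)%N ->
  divisor_sum (p ^ a * m) = (\sum_(i < a.+1) chi p ^+ i) * divisor_sum m.
Proof.
move=> p_pr m_gt0 p_m; elim: a => [|a IH].
  by rewrite expn0 mul1n big_ord1 expr0 mul1r.
rewrite /divisor_sum (perm_big _ (divisors_pfactorS a p_pr m_gt0 p_m)) big_cat /=.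
rewrite -/(divisor_sum _) IH big_map [in RHS]big_ord_recr mulrDl /=; congr (_ + _).
by rewrite mulr_sumr; apply: eq_bigr => d _; rewrite chiM chiX.
Qed.

Lemma sum_sign_pow_ge (x : R) a : x \in [:: 0; 1; -1] ->
  (~~ odd a)%:R <= \sum_(i < a.+1) x ^+ i.
Proof.
have b1 : (~~ odd a)%:R <= 1 :> R by case: odd; rewrite ?ler01.
rewrite !inE => /or3P[] /eqP->.
- by rewrite big_ord_recl expr0 big1 ?addr0 // => i _; rewrite expr0n.
- under eq_bigr do rewrite expr1n.
  by rewrite sumr_const card_ord ler_nat; case: odd.
- elim: a {b1} => [|a]; first by rewrite big_ord1 expr0.
  rewrite [in X in _ -> X]big_ord_recr /= -signr_odd oddS.
  by case: odd; rewrite ?expr1 ?expr0 /=; lra.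
Qed.

(** Multiplicativity reduces to the factors 1 + x + ... + x^a with x = chi(p), which are
    nonnegative, and at least 1 for even a; a square has only even exponents. *)
Lemma divisor_sum_ge n : (0 < n)%N -> 0 <= divisor_sum n /\
  ((exists m, n = m ^ 2)%N -> 1 <= divisor_sum n).
Proof.
elim/ltn_ind: n => n IH n_gt0; have [n1|n_gt1] := leqP n 1.
  have -> : n = 1%N by apply/eqP; rewrite eqn_leq n1.
  by rewrite /divisor_sum /= big_seq1 chi1; split.
have p_pr := pdiv_prime n_gt1; set p := pdiv n in p_pr.
have [m cop_pm nE] := pfactor_coprime p_pr n_gt0.
have m_gt0 : (0 < m)%N by move: n_gt0; rewrite nE muln_gt0 => /andP[].
have p_m : ~~ (p %| m)%N by rewrite -prime_coprime.
have l_gt0 : (0 < logn p n)%N by rewrite logn_gt0 mem_primes p_pr n_gt0 pdiv_dvd.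
have lt_mn : (m < n)%N.
  by rewrite nE -{1}[m]muln1 ltn_pmul2l // -(expn0 p) ltn_exp2l ?prime_gt1.
have [m_ge0 m_sq] := IH _ lt_mn m_gt0.
have -> : divisor_sum n = (\sum_(i < (logn p n).+1) chi p ^+ i) * divisor_sum m.
  by rewrite {1}nE mulnC divisor_sum_pfactor.
have s_ge := sum_sign_pow_ge (logn p n) (chi_sign p).
have s_ge0 : 0 <= \sum_(i < (logn p n).+1) chi p ^+ i by apply: le_trans s_ge; rewrite ler0n.
split=> [|[r rE]]; first by rewrite mulr_ge0.
have r_gt0 : (0 < r)%N by case: r rE n_gt0 => // ->.
have lE : logn p n = (logn p r).*2 by rewrite rE lognX mul2n.
rewrite lE odd_double /= in s_ge; rewrite -[1]mulr1 ler_pM // ?lE // m_sq //.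
have [e _ eE] := pfactor_coprime p_pr r_gt0; exists e.
apply/eqP; rewrite -(@eqn_pmul2r (p ^ logn p n)) ?expn_gt0 ?prime_gt0 // -nE rE {1}eE.
by rewrite expnMn lognX -expnM [(2 * _)%N]mulnC.
Qed.
End DivisorSum.

(** * The value L(1, chi) and Monsky's argument *)

Section RealCharacter.
Variables (R : realType) (chi : nat -> R) (B : R).
Hypotheses (chi1 : chi 1 = 1) (chiM : forall m n, chi (m * n) = chi m * chi n).
Hypothesis chi_sign : forall n, chi n \in [:: 0; 1; -1].
Hypothesis chi_sum : forall n, `|\sum_(1 <= i < n) chi i| <= B.

Definition Lsum n : R := \sum_(1 <= i < n.+1) chi i / i%:R.

Let B_ge0 : 0 <= B. Proof. exact: le_trans (chi_sum 0). Qed.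

Lemma chi_sum_from m n : (0 < m)%N -> `|\sum_(m <= i < n) chi i| <= 2 * B.
Proof.
move=> m_gt0; case: (leqP m n) => [mn|/ltnW nm]; last first.
  by rewrite big_geq // normr0 mulr_ge0.
have := chi_sum n; rewrite (big_cat_nat (n := m)) //= => sn.
have := chi_sum m; move: sn; move: (\sum_(1 <= i < m) _) (\sum_(m <= i < n) _) => x y.
by have := ler_normB (x + y) x; rewrite addrAC subrr add0r; lra.
Qed.

Lemma Lsum_dist m n : (0 < m)%N -> (m <= n)%N -> `|Lsum n - Lsum m| <= 2 * B / m%:R.
Proof.
move=> m_gt0 mn; rewrite /Lsum (big_cat_nat (n := m.+1)) //= addrAC subrr add0r.
have inv_mono i : (0 < i)%N -> 0 <= (i.+1%:R : R)^-1 <= i%:R^-1.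
  by move=> i_gt0; rewrite invr_ge0 ler0n /= lef_pV2 ?posrE ?ltr0n // ler_nat.
apply: le_trans (@abel_bound R chi (fun i => i%:R^-1) (2 * B) m.+1 n.+1 _ _) _.
- by move=> k; exact: chi_sum_from.
- by move=> i mi; apply: inv_mono; apply: leq_trans mi.
- rewrite ler_wpM2l ?mulr_ge0 //; first by have /andP[] := inv_mono m m_gt0.
Qed.

(** The limit is the supremum of the lower bounds L(n) - 2B/n, which by [Lsum_dist] stay below every
    upper bound L(m) + 2B/m. *)
Lemma Lsum_cvg : exists c, forall n, (0 < n)%N -> `|Lsum n - c| <= 2 * B / n%:R.
Proof.
pose E : set R := [set x | exists2 n, (0 < n)%N & x = Lsum n - 2 * B / n%:R].
have E_ub m : (0 < m)%N -> ubound E (Lsum m + 2 * B / m%:R).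
  move=> m_gt0 _ [n n_gt0 ->].
  have b_ge0 k : 0 <= 2 * B / k%:R :> R by rewrite !mulr_ge0 ?invr_ge0 ?ler0n.
  case: (leqP m n) => [|/ltnW] mn.
    by have := Lsum_dist m_gt0 mn; have := b_ge0 n; rewrite ler_norml; lra.
  by have := Lsum_dist n_gt0 mn; have := b_ge0 m; rewrite ler_norml; lra.
have E_sup : has_sup E.
  by split; [exists (Lsum 1 - 2 * B / 1%:R), 1%N|exists (Lsum 1 + 2 * B / 1%:R); exact: E_ub].
exists (sup E) => n n_gt0.
have le1 : Lsum n - 2 * B / n%:R <= sup E by apply: sup_upper_bound => //; exists n.
have le2 : sup E <= Lsum n + 2 * B / n%:R.
  by apply: ge_sup; [case: E_sup|exact: E_ub].
by rewrite ler_norml; lra.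
Qed.

Section Monsky.
Variable t : R.
Hypothesis t01 : 0 <= t <= 1.
Let t0 : 0 <= t. Proof. by case/andP: t01. Qed.
Let t1 : t <= 1. Proof. by case/andP: t01. Qed.

(* (1 - t) times Monsky's weight 1/(n (1 - t)) - t^n/(1 - t^n). *)
Let b n := n%:R^-1 - t ^+ n / geosum t n.

(** The difference b(n) - b(n+1) equals 1/(n(n+1)) - t^n/(G(n) G(n+1)) with G = [geosum t], so
    [geosum_mul_ge] applies. *)
Lemma monsky_decr n : (0 < n)%N -> 0 <= b n.+1 <= b n.
Proof.
have g_gt0 k : (0 < k)%N -> 0 < geosum t k.
  by move=> k_gt0; apply: lt_le_trans (geosum_ge1 t01 k_gt0).
move=> n_gt0; rewrite /b; apply/andP; split.
  rewrite subr_ge0 ler_pdivrMr ?g_gt0 // mulrC ler_pdivlMr ?ltr0n // mulrC.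
  exact: geosum_ge.
have n0 : n%:R != 0 :> R by rewrite pnatr_eq0 -lt0n.
have g0 := lt0r_neq0 (g_gt0 n n_gt0); have gS0 := lt0r_neq0 (g_gt0 n.+1 isT).
have gS : geosum t n.+1 = 1 + t * geosum t n.
  rewrite /geosum big_ord_recl expr0 mulr_sumr; congr (_ + _).
  by apply: eq_bigr => i _; rewrite -exprS.
rewrite -subr_ge0.
have -> : n%:R^-1 - t ^+ n / geosum t n - (n.+1%:R^-1 - t ^+ n.+1 / geosum t n.+1) =
   (n%:R * n.+1%:R)^-1 - t ^+ n / (geosum t n * geosum t n.+1).
  transitivity ((n%:R * n.+1%:R)^-1 - t ^+ n * (geosum t n.+1 - t * geosum t n) / (geosum t n * geosum t n.+1)).
    rewrite exprS; move: gS0 g0 n0; move: (geosum t n.+1) (geosum t n) (t ^+ n) => x y z x0 y0 n0.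
    have n1 : n%:R + 1 != 0 :> R by rewrite natr1 pnatr_eq0.
    by rewrite -natr1; field; rewrite x0 y0 n0 n1.
  by rewrite gS [1 + _ - _]addrK mulr1.
rewrite subr_ge0 ler_pdivrMr ?mulr_gt0 ?g_gt0 // mulrC ler_pdivlMr ?mulr_gt0 ?ltr0n //.
by rewrite mulrC; exact: geosum_mul_ge.
Qed.

(** Exchanging summations gives a sum over d of chi(d) (t^d + t^(2d) + ...). Its terms times 1 - t
    are chi(d)/d - chi(d) b(d), up to a truncation error of at most t^N each; Abel summation bounds
    the second part by B b(1) = B (1 - t). *)
Lemma monsky_bound N :
  (1 - t) * (\sum_(1 <= n < N.+1) divisor_sum chi n * t ^+ n) <=
  `|Lsum N| + B * (1 - t) + N%:R * t ^+ N.
Proof.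
have dsE n : (0 < n < N.+1)%N -> divisor_sum chi n = \sum_(1 <= d < N.+1 | (d %| n)%N) chi d.
  move=> /andP[n_gt0 nN]; rewrite /divisor_sum -[RHS]big_filter; apply: perm_big.
  apply: uniq_perm; rewrite ?divisors_uniq ?filter_uniq ?iota_uniq // => d.
  rewrite -dvdn_divisors // mem_filter mem_index_iota; case: (boolP (d %| n)%N) => // dn.
  by rewrite (dvdn_gt0 n_gt0 dn) /= (leq_ltn_trans (dvdn_leq n_gt0 dn)).
have -> : \sum_(1 <= n < N.+1) divisor_sum chi n * t ^+ n =
   \sum_(1 <= d < N.+1) chi d * \sum_(1 <= j < (N %/ d).+1) t ^+ (d * j).
  rewrite big_nat; under eq_bigr => n nN do rewrite dsE // mulr_suml.
  rewrite -big_nat (exchange_big_dep_nat xpredT) //= big_nat [RHS]big_nat.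
  apply: eq_bigr => d /andP[d_gt0 _]; rewrite -mulr_sumr; congr (_ * _).
  exact: (sum_multiples (fun n => t ^+ n)).
rewrite mulr_sumr.
have termE d : (0 < d < N.+1)%N ->
  (1 - t) * (chi d * \sum_(1 <= j < (N %/ d).+1) t ^+ (d * j)) =
  chi d / d%:R - chi d * b d - chi d * (t ^+ (d * (N %/ d).+1) / geosum t d).
  move=> /andP[d_gt0 dN]; have g0 : geosum t d != 0.
    by rewrite lt0r_neq0 // (lt_le_trans _ (geosum_ge1 t01 d_gt0)).
  have -> : \sum_(1 <= j < (N %/ d).+1) t ^+ (d * j) = t ^+ d * geosum (t ^+ d) (N %/ d).
    rewrite /geosum big_add1 /= big_mkord mulr_sumr; apply: eq_bigr => i _.
    by rewrite mulnS exprD exprM.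
  have e1 := geosumE t d; have e2 := geosumE (t ^+ d) (N %/ d).
  rewrite -exprM in e2; rewrite mulnS exprD /b.
  apply: (mulIf g0); move: e1 e2; move: (geosum (t ^+ d) _) => y.
  move: (geosum t d) g0 (t ^+ d) (t ^+ (d * _)) (chi d) => x x0 z w u e1 e2.
  have e3 : (1 - t) * (u * (z * y)) * x = u * z * (1 - w).
    by rewrite -e2 -e1; ring.
  rewrite e3; move: d_gt0; rewrite lt0n -(pnatr_eq0 R) => d0.
  by field; rewrite x0 d0.
rewrite big_nat (eq_bigr _ termE) -big_nat !sumrB -/(Lsum N).
apply: le_trans (ler_norm _) _; apply: le_trans (ler_normB _ _) _; apply: lerD.
  apply: le_trans (ler_normB _ _) _; rewrite lerD2l.
  apply: le_trans (@abel_bound R chi b B 1 N.+1 _ _) _; [exact: chi_sum|by move=> i; exact: monsky_decr|].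
  by rewrite /b invr1 expr1 /geosum big_ord1 expr0 divr1.
apply: le_trans (ler_norm_sum _ _ _) _.
have -> : N%:R * t ^+ N = \sum_(1 <= d < N.+1) t ^+ N.
  by rewrite sumr_const_nat subn1 mulr_natl.
rewrite big_nat [leRHS]big_nat; apply: ler_sum => d /andP[d_gt0 dN].
have g1 := geosum_ge1 t01 d_gt0.
rewrite !normrM normfV (ger0_norm (exprn_ge0 _ t0)) (ger0_norm (le_trans ler01 g1)).
have Nd : (N <= d * (N %/ d).+1)%N by rewrite ltnW // mulnC ltn_ceil.
rewrite -[leRHS]mul1r ler_pM ?mulr_ge0 ?invr_ge0 ?exprn_ge0 ?(le_trans ler01 g1) ?chi_norm //.
rewrite ler_pdivrMr ?(lt_le_trans _ g1) // -[leLHS]mulr1 ler_pM ?exprn_ge0 //.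
by rewrite ler_wiXn2l.
Qed.

End Monsky.

(** The first m squares alone contribute this much, since [divisor_sum] is at least 1 on squares and
    nonnegative elsewhere. *)
Lemma divisor_sum_squares_ge t m N : 0 <= t <= 1 -> (m ^ 2 <= N)%N ->
  m%:R * t ^+ (m ^ 2) <= \sum_(1 <= n < N.+1) divisor_sum chi n * t ^+ n.
Proof.
move=> /andP[t0 t1] mN.
have sq_count n : (0 < n)%N ->
    \sum_(1 <= j < m.+1) (n == j ^ 2)%N%:R <= divisor_sum chi n.
  move=> n_gt0; have [ds_ge0 ds_sq] := divisor_sum_ge chi1 chiM chi_sign n_gt0.
  case: (pselect (exists j, n = j ^ 2)%N) => [[j /eqP nj]|nsq]; last first.
    by rewrite big1 // => j _; case: eqP => // nj; case: nsq; exists j.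
  apply: le_trans (ds_sq _); last by exists j; apply/eqP.
  rewrite (eq_bigr (fun i => if i == j then 1 else 0)) => [|i _]; last first.
    by rewrite (eqP nj) eqn_exp2r // eq_sym; case: (i == j).
  by rewrite -big_mkcond big_nat1_eq; case: ifP.
apply: (@le_trans _ _ (\sum_(1 <= n < N.+1) \sum_(1 <= j < m.+1) (n == j ^ 2)%N%:R * t ^+ n)); last first.
  rewrite big_nat [leRHS]big_nat; apply: ler_sum => n /andP[n_gt0 _].
  by rewrite -mulr_suml ler_wpM2r ?exprn_ge0 ?sq_count.
rewrite exchange_big /=.
have -> : m%:R * t ^+ (m ^ 2) = \sum_(1 <= j < m.+1) t ^+ (m ^ 2).
  by rewrite sumr_const_nat subn1 mulr_natl.
rewrite [leLHS]big_nat [leRHS]big_nat; apply: ler_sum => j /andP[j_gt0 jm].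
rewrite (eq_bigr (fun n => if n == (j ^ 2)%N then t ^+ n else 0)) => [|n _]; last first.
  by case: eqP => _; rewrite ?mul1r ?mul0r.
have jm2 : (j ^ 2 <= m ^ 2)%N by rewrite leq_exp2r.
rewrite -big_mkcond big_nat1_eq expn_gt0 j_gt0 /= ltnS (leq_trans jm2 mN).
by rewrite ler_wiXn2l.
Qed.

Lemma pow_sub1_le (x : R) n : 0 <= x <= 1 -> (1 - x) ^+ n * (1 + n%:R * x) <= 1.
Proof.
move=> /andP[x0 x1]; elim: n => [|n IH]; first by rewrite expr0 mul0r addr0 mulr1.
apply: le_trans IH; rewrite exprSr -mulrA ler_wpM2l ?exprn_ge0 ?subr_ge0 //.
rewrite -natr1; have : 0 <= n%:R * x * x by rewrite !mulr_ge0.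
by move: n%:R => y; nra.
Qed.

Lemma pow_sub1_ge (x : R) n : 0 <= x <= 1 -> 1 - n%:R * x <= (1 - x) ^+ n.
Proof.
move=> /andP[x0 x1]; elim: n => [|n IH]; first by rewrite expr0 mul0r subr0.
rewrite exprS; have : (1 - x) * (1 - n%:R * x) <= (1 - x) * (1 - x) ^+ n.
  by rewrite ler_wpM2l ?subr_ge0.
apply: le_trans; rewrite -natr1; have : 0 <= n%:R * x * x by rewrite !mulr_ge0.
by move: n%:R => y; nra.
Qed.

(* If L(1) = 0, monsky_bound keeps the divisor series bounded as t = 1 - 1/K -> 1, whereas its
   square terms contribute about sqrt K. *)
Lemma L1_neq0 c : (forall n, (0 < n)%N -> `|Lsum n - c| <= 2 * B / n%:R) -> c != 0.
Proof.
move=> Lc; apply/eqP => c0.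
suff bound m : (0 < m)%N -> m%:R <= 4 * (3 * B + 1).
  have B1_ge0 : 0 <= 4 * (3 * B + 1) by have := B_ge0; lra.
  have b_gt := archi_boundP B1_ge0.
  by have := le_lt_trans B1_ge0 b_gt; rewrite ltr0n => /bound; rewrite leNgt b_gt.
(* K is the square of 2^m, so the squares up to K contribute at least 2^m t^K, and t^K >= 1/4; M is
   large enough for N t^N <= 1/K. *)
move=> m_gt0; pose K := (4 ^ m)%N; pose M := (2 * K ^ 2)%N; pose N := (K * M)%N.
have K_gt0 : (0 < K)%N by rewrite expn_gt0.
have M_gt0 : (0 < M)%N by rewrite muln_gt0 expn_gt0 K_gt0.
have KR : 0 < K%:R :> R by rewrite ltr0n.
have K1 : 0 <= (K%:R : R)^-1 <= 1 by rewrite invr_ge0 ltW //= invf_le1 // ler1n.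
pose t : R := 1 - K%:R^-1.
have t01 : 0 <= t <= 1 by rewrite /t; lra.
have t_half : t ^+ K <= 2^-1.
  have := pow_sub1_le K K1; rewrite -/t divff ?lt0r_neq0 //; lra.
(* Bernoulli at the exponent K/2 gives 1/2, which is then squared; at the exponent K it would give
   only 0. *)
have t_quarter : 4^-1 <= t ^+ K.
  have [h hE] : exists h, K = (h * 2)%N.
    by exists (2 * 4 ^ m.-1)%N; rewrite mulnC mulnA -expnS prednK.
  rewrite hE exprM.
  have := pow_sub1_ge h K1; rewrite -/t {1}hE natrM invfM mulrA divff; last first.
    by rewrite pnatr_eq0; apply: contra_eqN K_gt0; rewrite hE => /eqP->.
  rewrite mul1r expr2; move: (t ^+ h) => x x2.
  have : 0 <= (x - 2^-1) * (x + 2^-1) by rewrite mulr_ge0 //; lra.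
  by lra.
have KM : (K * N <= 2 ^ M)%N.
  rewrite /N /M mulnA; set j := (K ^ 2)%N; have j_gt0 : (0 < j)%N by rewrite expn_gt0 K_gt0.
  have -> : (K * K = j)%N by rewrite /j mulnn.
  have j2 : (2 * j <= 2 ^ j)%N.
    rewrite -(prednK j_gt0) expnS leq_pmul2l // ltn_expl //.
  rewrite [in (2 ^ _)%N]mul2n -addnn expnD; apply: leq_mul => //.
  by apply: leq_trans j2; rewrite leq_pmull.
have tN : K%:R * (N%:R * t ^+ N) <= 1.
  have -> : t ^+ N = (t ^+ K) ^+ M by rewrite -exprM.
  have tM : (t ^+ K) ^+ M <= (2 ^+ M)^-1.
    by rewrite -exprVn ler_pXn2r ?nnegrE ?exprn_ge0 ?invr_ge0 //; case/andP: t01.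
  rewrite mulrA -natrM; apply: (@le_trans _ _ ((K * N)%:R * (2 ^+ M)^-1)).
    by rewrite ler_wpM2l.
  by rewrite ler_pdivrMr ?exprn_gt0 // mul1r -natrX ler_nat.
have LN : K%:R * `|Lsum N| <= 2 * B.
  have N_gt0 : (0 < N)%N by rewrite muln_gt0 K_gt0.
  have := Lc N N_gt0; rewrite c0 subr0 => LN.
  apply: (@le_trans _ _ (K%:R * (2 * B / N%:R))); first by rewrite ler_wpM2l // ltW.
  have MR : 0 < M%:R :> R by rewrite ltr0n.
  have -> : K%:R * (2 * B / N%:R) = 2 * B / M%:R.
    by rewrite natrM; field; rewrite !lt0r_neq0.
  by rewrite ler_pdivrMr // ler_peMr ?mulr_ge0 // ler1n.
have lower : 2 ^+ m * t ^+ K <= \sum_(1 <= n < N.+1) divisor_sum chi n * t ^+ n.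
  have KE : K = ((2 ^ m) ^ 2)%N by rewrite -expnM mulnC expnM.
  rewrite [in t ^+ K]KE -natrX; apply: divisor_sum_squares_ge => //.
  by rewrite -KE leq_pmulr.
have upper := monsky_bound t01 N.
have tK : K%:R * (1 - t) = 1 by rewrite /t opprD addNKr opprK divff ?lt0r_neq0.
have {}upper : \sum_(1 <= n < N.+1) divisor_sum chi n * t ^+ n <= 3 * B + 1.
  move: upper; rewrite -(ler_pM2l KR) [leLHS]mulrA tK mul1r => /le_trans; apply.
  have -> : K%:R * (`|Lsum N| + B * (1 - t) + N%:R * t ^+ N) =
      K%:R * `|Lsum N| + B * (K%:R * (1 - t)) + K%:R * (N%:R * t ^+ N) by ring.
  by rewrite tK mulr1; lra.
have m2 : m%:R <= 2 ^+ m :> R by rewrite -natrX ler_nat ltnW // ltn_expl.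
have m4 : m%:R * 4^-1 <= 2 ^+ m * t ^+ K by apply: ler_pM => //; rewrite invr_ge0.
by have := le_trans m4 (le_trans lower upper); lra.
Qed.
End RealCharacter.

(** * Sums of chi(p) ln p / p over primes *)

Section LogSums.
Variable R : realType.
Notation lnn n := (ln (n%:R : R)).

Lemma lnn_ge0 n : 0 <= lnn n.
Proof. by case: n => [|n]; [rewrite ln0|rewrite ln_ge0 // ler1n]. Qed.

Lemma lnn_succ_sub_le n : (0 < n)%N -> lnn n.+1 - lnn n <= n%:R^-1.
Proof.
move=> n_gt0; have n0 : 0 < n%:R :> R by rewrite ltr0n.
rewrite -ln_div ?posrE ?ltr0n //.
have -> : n.+1%:R / n%:R = 1 + n%:R^-1 :> R.
  by rewrite -natr1 mulrDl divff ?lt0r_neq0 // mul1r.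
by apply: le_ln1Dx; apply: lt_trans (_ : 0 < _); rewrite ?ltrN10 // invr_gt0.
Qed.

Lemma lnn_succ_le n : (0 < n)%N -> n%:R * (lnn n.+1 - lnn n) <= 1.
Proof.
move=> n_gt0; have n0 : 0 < n%:R :> R by rewrite ltr0n.
by rewrite mulrC -ler_pdivlMr // mul1r lnn_succ_sub_le.
Qed.

Lemma lnn2_le1 : lnn 2 <= 1.
Proof.
have -> : 2%:R = 1 + 1 :> R by rewrite -natr1.
by apply: le_ln1Dx; apply: lt_trans (ltrN10 _) ltr01.
Qed.

Lemma ln_prod_nat (I : eqType) (r : seq I) (P : pred I) (F : I -> nat) :
  (forall i, i \in r -> P i -> (0 < F i)%N) ->
  lnn (\prod_(i <- r | P i) F i)%N = \sum_(i <- r | P i) lnn (F i).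
Proof.
elim: r => [|i r IH] F0; first by rewrite !big_nil ln1.
have {}IH : lnn (\prod_(i <- r | P i) F i)%N = \sum_(i <- r | P i) lnn (F i).
  by apply: IH => j jr; apply: F0; rewrite in_cons jr orbT.
rewrite !big_cons; case: ifP => // Pi; rewrite natrM lnM ?IH // posrE ltr0n.
  by rewrite F0 ?mem_head.
by rewrite big_seq_cond prodn_cond_gt0 // => j /andP[jr]; apply: F0; rewrite in_cons jr orbT.
Qed.

Lemma logn_sum_dvd p n N : prime p -> (0 < n <= N)%N ->
  logn p n = (\sum_(1 <= k < N.+1) (p ^ k %| n))%N.
Proof.
move=> p_pr /andP[n_gt0 nN]; rewrite logn_count_dvd // [RHS](big_cat_nat (n := n)) //=; last exact: ltnW.
rewrite [X in (_ = _ + X)%N]big_nat [X in (_ = _ + X)%N]big1 ?addn0 // => k /andP[nk _].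
by rewrite gtnNdvd // (leq_ltn_trans nk) // ltn_expl // prime_gt1.
Qed.

Lemma lnn_sum_primes n N : (0 < n <= N)%N ->
  lnn n = \sum_(0 <= p < N.+1 | prime p) \sum_(1 <= k < N.+1) lnn p * (p ^ k %| n)%N%:R.
Proof.
move=> /andP[n_gt0 nN].
rewrite -{1}(partnT n_gt0) (widen_partn _ nN) ln_prod_nat => [|p _ _]; last first.
  by rewrite expn_gt0; case: p => //; rewrite logn0 // eqxx orbT.
rewrite [RHS]big_mkcond; apply: eq_bigr => p _; case: ifP => [p_pr|p_pr]; last first.
  by rewrite lognE p_pr expn0 ln1.
rewrite natrX lnXn ?ltr0n ?prime_gt0 // (logn_sum_dvd p_pr (N := N)) ?n_gt0 // -[LHS]mulr_natr.
  by rewrite natr_sum mulr_sumr.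
Qed.

(** This is the identity of ln with the divisor sum of the von Mangoldt function, summed against f;
    prime powers above N have empty inner sums. *)
Lemma sum_mul_lnn (f : nat -> R) N :
  \sum_(1 <= n < N.+1) f n * lnn n =
  \sum_(0 <= p < N.+1 | prime p) \sum_(1 <= k < N.+1)
    lnn p * \sum_(1 <= j < (N %/ p ^ k).+1) f (p ^ k * j)%N.
Proof.
rewrite big_nat (eq_bigr (fun n => \sum_(0 <= p < N.+1 | prime p) \sum_(1 <= k < N.+1)
    f n * (lnn p * (p ^ k %| n)%N%:R))) => [|n nN]; last first.
  rewrite (lnn_sum_primes (N := N)) ?mulr_sumr //.
  by apply: eq_bigr => p _; rewrite mulr_sumr.
rewrite -big_nat exchange_big /=; apply: eq_bigr => p p_pr.
rewrite exchange_big /=; apply: eq_bigr => k _.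
rewrite -sum_multiples ?expn_gt0 ?prime_gt0 // mulr_sumr [RHS]big_mkcond.
by apply: eq_bigr => n _; case: ifP => _; rewrite ?mulr1 ?mulr0 1?mulrC.
Qed.

Lemma sum_inv_pow_le p N : (1 < p)%N ->
  \sum_(2 <= k < N.+1) ((p ^ k)%:R : R)^-1 <= (p%:R * (p%:R - 1))^-1.
Proof.
move=> p_gt1; have p1 : 0 < p%:R - 1 :> R by rewrite subr_gt0 ltr1n.
have p0 : 0 < p%:R :> R by rewrite ltr0n ltnW.
suff -> : \sum_(2 <= k < N.+1) ((p ^ k)%:R : R)^-1 =
    if (N < 2)%N then 0 else (p%:R * (p%:R - 1))^-1 - ((p ^ N)%:R * (p%:R - 1))^-1.
  by case: ifP => _; rewrite ?gerBl invr_ge0 mulr_ge0 // ltW.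
elim: N => [|N IH]; first by rewrite big_geq.
case: N IH => [|[|N]] IH; first by rewrite big_geq.
  rewrite big_nat1 /= !natrX expr2; field; rewrite ?lt0r_neq0 //.
rewrite big_nat_recr // IH /= !natrX [p%:R ^+ N.+3]exprS.
have pN : p%:R ^+ N.+2 != 0 :> R by rewrite expf_neq0 // lt0r_neq0.
by move: (p%:R ^+ N.+2) pN => x x0; field; rewrite x0 !lt0r_neq0.
Qed.

Lemma sum_lnn_over_sqr_le N :
  \sum_(0 <= p < N.+1 | prime p) lnn p / (p%:R * (p%:R - 1)) <= 2.
Proof.
(* The decrements of [g] dominate the terms of the sum, and the final bound 2 is its value at 1. *)
pose g n : R := (lnn n + 2) / n%:R.
have term_ge0 n : 0 <= lnn n / (n%:R * (n%:R - 1)).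
  case: n => [|n]; first by rewrite mul0r invr0 mulr0.
  by rewrite mulr_ge0 ?lnn_ge0 // invr_ge0 mulr_ge0 // subr_ge0 ler1n.
have step n : (0 < n)%N -> lnn n.+1 / (n.+1%:R * (n.+1%:R - 1)) <= g n - g n.+1.
  move=> n_gt0; have n0 : 0 < n%:R :> R by rewrite ltr0n.
  have e := lnn_succ_sub_le n_gt0; have e2 := lnn_succ_le n_gt0.
  rewrite /g; set l1 := lnn n.+1 in e e2 *; rewrite -natr1 addrK.
  have -> : (lnn n + 2) / n%:R - (l1 + 2) / (n%:R + 1) =
     (lnn n + n%:R * (lnn n - l1) + 2) / ((n%:R + 1) * n%:R).
    by field; rewrite !lt0r_neq0 // natr1 ltr0n.
  rewrite ler_pM2r ?invr_gt0 ?mulr_gt0 ?natr1 ?ltr0n //.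
  have n1 : n%:R^-1 <= 1 :> R by rewrite invf_le1 // ler1n.
  lra.
apply: le_trans (sum_nat_subset prime 0 N.+1 term_ge0) _.
have sum_le m : \sum_(2 <= p < m.+2) lnn p / (p%:R * (p%:R - 1)) <= g 1%N - g m.+1.
  elim: m => [|m IH]; first by rewrite big_geq // subrr.
  by rewrite big_nat_recr //; apply: le_trans (lerD IH (step m.+1 isT)) _; rewrite addrA subrK.
apply: (@le_trans _ _ (\sum_(0 <= p < N.+2) lnn p / (p%:R * (p%:R - 1)))).
  by rewrite ler_sum_nat_widen.
(* The terms at 0 and 1 vanish because the inverse of 0 is 0. *)
rewrite (big_cat_nat (n := 2)) //= big_nat_recr //= big_nat1 mul0r invr0 mulr0 add0r.
rewrite subrr mulr0 invr0 mulr0 add0r.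
apply: le_trans (sum_le N) _.
have g_ge0 : 0 <= g N.+1 by rewrite /g mulr_ge0 ?invr_ge0 // addr_ge0 ?lnn_ge0.
by rewrite {1}/g ln1 add0r divr1; lra.
Qed.

(** The product bound is applied at the next power of two, which is at most 2N, and ln 4 <= 2. *)
Lemma chebyshev_theta_le N : \sum_(0 <= p < N.+1 | prime p) lnn p <= 4 * N%:R.
Proof.
have [->|N_gt0] := posnP N; first by rewrite big_mkcond big_nat1 mulr0.
set j := trunc_log 2 N.
have jN : (2 ^ j <= N)%N by apply: trunc_logP.
have Nj : (N < 2 ^ j.+1)%N by apply: trunc_log_ltn.
apply: (@le_trans _ _ (\sum_(0 <= p < (2 ^ j.+1).+1 | prime p) lnn p)).
  rewrite !(big_mkcond prime) /=; apply: ler_sum_nat_widen; first by rewrite ltnS ltnW.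
  by move=> p; case: ifP => // _; rewrite lnn_ge0.
rewrite -ln_prod_nat => [|p _ /prime_gt0 //].
apply: (@le_trans _ _ (lnn (4 ^ (2 ^ j.+1))%N)).
  rewrite ler_ln ?posrE ?ltr0n ?expn_gt0 ?prodn_cond_gt0 ?ler_nat ?prod_primes_le4 //.
  by move=> p /prime_gt0.
have ln2 := lnn2_le1.
have ln4 : lnn 4 = lnn 2 + lnn 2 by rewrite -lnM ?posrE // -natrM.
rewrite natrX lnXn // -[leLHS]mulr_natr ln4.
have : (2 ^ j.+1)%:R <= 2 * N%:R :> R by rewrite expnS natrM ler_pM2l // ler_nat.
have : (lnn 2 + lnn 2) * (2 ^ j.+1)%:R <= 2 * (2 ^ j.+1)%:R.
  by rewrite ler_wpM2r //; lra.
by move=> /le_trans le1 le2; apply: le1; lra.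
Qed.

(* Divergence follows from sum_(n <= N) ln n <= N * sum_p ln p * (1/p + 1/p^2 + ...). *)
Lemma sum_lnn_over_prime_unbounded (C : R) :
  exists N, C < \sum_(0 <= p < N.+1 | prime p) lnn p / p%:R.
Proof.
have key M : (0 < M)%N ->
    lnn M / 2 - 2 <= \sum_(0 <= p < (M.*2).+1 | prime p) lnn p / p%:R.
  move=> M_gt0; set N := M.*2; set S := \sum_(_ <= p < _ | _) _.
  have N_gt0 : 0 < N%:R :> R by rewrite ltr0n double_gt0.
  have lower : M%:R * lnn M <= \sum_(1 <= n < N.+1) 1 * lnn n.
    have MN : (M.+1 <= N.+1)%N by rewrite ltnS /N -addnn leq_addr.
    rewrite (big_cat_nat (n := M.+1)) //=.
    have -> : M%:R * lnn M = \sum_(M.+1 <= n < N.+1) lnn M.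
      by rewrite sumr_const_nat subSS /N -addnn addnK mulr_natl.
    rewrite -[leLHS]add0r lerD //; first by apply: sumr_ge0 => i _; rewrite mul1r lnn_ge0.
    rewrite [leLHS]big_nat [leRHS]big_nat; apply: ler_sum => n /andP[Mn _].
    by rewrite mul1r ler_ln ?posrE ?ltr0n ?ler_nat // ltnW // (leq_ltn_trans _ Mn).
  have upper : \sum_(1 <= n < N.+1) 1 * lnn n <= N%:R * (S + 2).
    rewrite (sum_mul_lnn (fun=> 1)).
    apply: (@le_trans _ _ (\sum_(0 <= p < N.+1 | prime p)
        N%:R * (lnn p / p%:R + lnn p / (p%:R * (p%:R - 1))))); last first.
      by rewrite -mulr_sumr ler_wpM2l // big_split lerD2l sum_lnn_over_sqr_le.
    apply: ler_sum => p p_pr; have p_gt0 := prime_gt0 p_pr.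
    rewrite -mulrDr mulrCA -mulr_sumr ler_wpM2l ?lnn_ge0 //.
    apply: (@le_trans _ _ (\sum_(1 <= k < N.+1) N%:R * ((p ^ k)%:R)^-1)).
      apply: ler_sum => k _; rewrite sumr_const_nat subn1 /=.
      by rewrite ler_pdivlMr ?ltr0n ?expn_gt0 ?p_gt0 // -natrM ler_nat leq_trunc_div.
    rewrite -mulr_sumr ler_wpM2l // big_nat_recl ?double_gt0 //= expn1 lerD2l.
    by have le_sum := sum_inv_pow_le N (prime_gt1 p_pr); rewrite big_add1 in le_sum.
  have := le_trans lower upper; rewrite /N -addnn natrD => le_MS.
  have : M%:R * lnn M <= M%:R * (2 * (S + 2)) by lra.
  by rewrite ler_pM2l ?ltr0n //; lra.
pose x := sequences.expR (2 * (`|C| + 3)) : R.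
have x_gt0 : 0 < x by exact: expR_gt0.
have b_gt := archi_boundP (ltW x_gt0); set M := Num.bound x in b_gt.
have M_gt0 : (0 < M)%N by rewrite -(ltr0n R) (lt_trans x_gt0).
exists M.*2; apply: lt_le_trans (key M M_gt0).
have : 2 * (`|C| + 3) <= lnn M.
  by rewrite -[leLHS]expRK ler_ln ?posrE ?ltr0n // ltW.
by have := ler_norm C; lra.
Qed.
End LogSums.

Section PrimeCharacterSum.
Variables (R : realType) (chi : nat -> R) (B : R).
Hypotheses (chi1 : chi 1 = 1) (chiM : forall m n, chi (m * n) = chi m * chi n).
Hypothesis chi_sign : forall n, chi n \in [:: 0; 1; -1].
Hypothesis chi_sum : forall n, `|\sum_(1 <= i < n) chi i| <= B.
Notation lnn n := (ln (n%:R : R)).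
Let B_ge0 : 0 <= B. Proof. exact: le_trans (chi_sum 0). Qed.

(** ln x / x decreases once ln x >= 1; starting at 4 keeps this elementary, since ln(1/2) <= -1/2
    gives ln 4 >= 1. *)
Lemma lnn_over_decr i : (4 <= i)%N -> 0 <= lnn i.+1 / i.+1%:R <= lnn i / i%:R.
Proof.
move=> i4; have i0 : (0 < i)%N by apply: leq_trans i4.
have i_gt0 : 0 < i%:R :> R by rewrite ltr0n.
rewrite mulr_ge0 ?lnn_ge0 ?invr_ge0 //= ler_pdivrMr ?ltr0n // mulrAC ler_pdivlMr //.
have ln_half : ln (2^-1 : R) <= - 2^-1.
  have := @le_ln1Dx R (- 2^-1); have -> : 1 - 2^-1 = 2^-1 :> R by lra.
  by apply; lra.
have ln4 : 1 <= lnn 4.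
  have -> : 4%:R = (2^-1 * 2^-1)^-1 :> R by rewrite -invfM invrK -natrM.
  rewrite lnV ?posrE ?mulr_gt0 ?invr_gt0 // lnM ?posrE ?invr_gt0 //; lra.
have ln_i : 1 <= lnn i.
  by apply: le_trans ln4 _; rewrite ler_ln ?posrE ?ler_nat ?ltr0n //; apply: leq_trans i4.
have e := lnn_succ_le R i0.
have -> : lnn i * i.+1%:R = lnn i * i%:R + lnn i by rewrite -natr1 mulrDr mulr1.
by move: e; rewrite mulrBr; lra.
Qed.

Lemma sum_chi_lnn_bounded : exists C : R, forall N,
  `|\sum_(1 <= n < N.+1) chi n / n%:R * lnn n| <= C.
Proof.
pose u n := chi n / n%:R * lnn n.
exists (\sum_(1 <= n < 4) `|u n| + 2 * B * (lnn 4 / 4%:R)) => N.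
have u4 n : `|\sum_(4 <= i < n) u i| <= 2 * B * (lnn 4 / 4%:R).
  under eq_bigr do rewrite /u mulrAC -mulrA.
  by apply: abel_bound => [k|i]; [exact: chi_sum_from|exact: lnn_over_decr].
have [N4|/ltnW N4] := leqP 4 N.+1.
  rewrite (big_cat_nat (n := 4)) //=; apply: le_trans (ler_normD _ _) _.
  by rewrite lerD // ler_norm_sum.
apply: le_trans (ler_norm_sum _ _ _) _; rewrite -[leLHS]addr0 lerD //.
  by apply: ler_sum_nat_widen.
by apply: le_trans (u4 0); rewrite normr_ge0.
Qed.

(** In the bounded sum of chi(n) ln n / n, expand ln n over prime powers. A prime p contributes
    chi(p) ln p / p times the partial sum of L(1, chi) up to N/p, which is the limit c up to O(p/N).
    These errors add up to O(1) by Chebyshev, the higher prime powers converge absolutely, and c <>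
    0 is divided out. *)
Lemma sum_chi_primes_bounded : exists C : R, forall N,
  `|\sum_(0 <= p < N.+1 | prime p) chi p * (lnn p / p%:R)| <= C.
Proof.
have [c Lc] := Lsum_cvg chi_sum; have c0 := L1_neq0 chi1 chiM chi_sign chi_sum Lc.
have [C1 C1P] := sum_chi_lnn_bounded.
pose BL : R := `|c| + 2 * B.
have BL_ge0 : 0 <= BL by rewrite addr_ge0 // mulr_ge0.
have L_le n : `|Lsum chi n| <= BL.
  case: n => [|n]; first by rewrite /Lsum big_geq // normr0.
  have le2B : 2 * B / n.+1%:R <= 2 * B.
    by rewrite ler_pdivrMr // ler_peMr ?mulr_ge0 // ler1n.
  rewrite -[Lsum chi n.+1](subrK c) /BL addrC; apply: le_trans (ler_normD _ _) _.
  by rewrite lerD2l (le_trans (Lc n.+1 isT)).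
exists ((C1 + 2 * BL + 16 * B) / `|c|) => N.
set S := \sum_(_ <= _ < _ | _) _.
rewrite ler_pdivlMr ?normr_gt0 // mulrC -normrM.
have [N0|N_gt0] := posnP N.
  rewrite /S N0 big_mkcond big_nat1 mulr0 normr0 !addr_ge0 ?mulr_ge0 //.
  exact: le_trans (C1P 0%N).
pose T := \sum_(1 <= n < N.+1) chi n / n%:R * lnn n.
pose rest p := \sum_(2 <= k < N.+1) lnn p * (chi (p ^ k) / (p ^ k)%:R * Lsum chi (N %/ p ^ k)).
have TE : T = \sum_(0 <= p < N.+1 | prime p)
    (c * (chi p * (lnn p / p%:R)) + chi p * (lnn p / p%:R) * (Lsum chi (N %/ p) - c) + rest p).
  rewrite /T (sum_mul_lnn (fun n => chi n / n%:R)); apply: eq_bigr => p p_pr.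
  rewrite (eq_bigr (fun k => lnn p * (chi (p ^ k) / (p ^ k)%:R * Lsum chi (N %/ p ^ k)))) => [|k _].
    rewrite (big_cat_nat (n := 2)) //= big_nat1 expn1 -/(rest p); congr (_ + _).
    by ring.
  congr (_ * _); rewrite /Lsum mulr_sumr; apply: eq_bigr => j _.
  by rewrite chiM natrM invfM; ring.
have restP p : prime p -> `|rest p| <= BL * (lnn p / (p%:R * (p%:R - 1))).
  move=> p_pr; rewrite /rest -mulr_sumr normrM (ger0_norm (lnn_ge0 _ _)) mulrCA ler_wpM2l ?lnn_ge0 //.
  apply: le_trans (ler_norm_sum _ _ _) _.
  apply: (@le_trans _ _ (\sum_(2 <= k < N.+1) BL * ((p ^ k)%:R)^-1)); last first.
    by rewrite -mulr_sumr ler_wpM2l // sum_inv_pow_le ?prime_gt1.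
  apply: ler_sum => k _; rewrite !normrM normfV normr_nat mulrC.
  rewrite ler_pM ?mulr_ge0 ?invr_ge0 // -[leRHS]mul1r ler_wpM2r ?invr_ge0 //.
  exact: chi_norm.
have errP p : prime p -> (p < N.+1)%N ->
    `|chi p * (lnn p / p%:R) * (Lsum chi (N %/ p) - c)| <= 4 * B / N%:R * lnn p.
  move=> p_pr pN; have p_gt0 := prime_gt0 p_pr.
  have Np_gt0 : (0 < N %/ p)%N by rewrite divn_gt0.
  (* floor(N/p) >= N/(2p), because p <= N. *)
  have Np : (N <= 2 * p * (N %/ p))%N.
    by have := ltn_ceil N p_gt0; move: (N %/ p)%N Np_gt0 => x; nia.
  have NR : 0 < N%:R :> R by rewrite ltr0n.
  have pR : 0 < p%:R :> R by rewrite ltr0n.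
  have xR : 0 < (N %/ p)%:R :> R by rewrite ltr0n.
  have Linv : 2 * B / (N %/ p)%:R <= 4 * B / N%:R * p%:R.
    have e : 4 * B / N%:R * p%:R * (N %/ p)%:R = 4 * B * (p%:R * (N %/ p)%:R) / N%:R by ring.
    rewrite ler_pdivrMr // e ler_pdivlMr //.
    have -> : 4 * B * (p%:R * (N %/ p)%:R) = 2 * B * (2 * p * (N %/ p))%:R by rewrite !natrM; ring.
    by rewrite ler_wpM2l ?mulr_ge0 // ler_nat.
  rewrite !normrM normfV normr_nat (ger0_norm (lnn_ge0 _ _)).
  apply: (@le_trans _ _ (1 * (lnn p / p%:R) * (4 * B / N%:R * p%:R))).
    rewrite ler_pM ?mulr_ge0 ?invr_ge0 ?lnn_ge0 //.
      by rewrite ler_wpM2r ?mulr_ge0 ?invr_ge0 ?lnn_ge0 // chi_norm.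
    by apply: le_trans (Lc _ Np_gt0) Linv.
  by rewrite mul1r le_eqVlt; apply/orP; left; apply/eqP; field; rewrite !lt0r_neq0.
have cS : c * S = T - \sum_(0 <= p < N.+1 | prime p) chi p * (lnn p / p%:R) * (Lsum chi (N %/ p) - c)
    - \sum_(0 <= p < N.+1 | prime p) rest p.
  by rewrite TE !big_split /= -mulr_sumr -/S; ring.
rewrite cS; apply: le_trans (ler_normB _ _) _.
have b2 : `|\sum_(0 <= p < N.+1 | prime p) rest p| <= 2 * BL.
  apply: le_trans (ler_norm_sum _ _ _) _.
  apply: (@le_trans _ _ (\sum_(0 <= p < N.+1 | prime p) BL * (lnn p / (p%:R * (p%:R - 1))))).
    by apply: ler_sum => p; exact: restP.
  by rewrite -mulr_sumr mulrC ler_wpM2r // sum_lnn_over_sqr_le.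
have b3 : `|\sum_(0 <= p < N.+1 | prime p) chi p * (lnn p / p%:R) * (Lsum chi (N %/ p) - c)| <= 16 * B.
  apply: le_trans (ler_norm_sum _ _ _) _.
  apply: (@le_trans _ _ (\sum_(0 <= p < N.+1 | prime p) 4 * B / N%:R * lnn p)).
    by rewrite big_nat_cond [leRHS]big_nat_cond; apply: ler_sum => p /andP[/andP[_ pN] p_pr]; exact: errP.
  rewrite -mulr_sumr; have NR : 0 < N%:R :> R by rewrite ltr0n.
  have th := chebyshev_theta_le R N.
  apply: (@le_trans _ _ (4 * B / N%:R * (4 * N%:R))).
    by rewrite ler_wpM2l // !mulr_ge0 // invr_ge0.
  by rewrite le_eqVlt; apply/orP; left; apply/eqP; field; rewrite lt0r_neq0.
rewrite [leRHS]addrAC lerD //; apply: le_trans (ler_normB _ _) _.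
by rewrite lerD // C1P.
Qed.
End PrimeCharacterSum.

(** * Primes with prescribed quadratic characters *)

Section PrescribedSigns.
Variable R : realType.

(** Complete periods cancel and the remainder has fewer than M terms; the extra 1 pays for the
    omitted term at 0. *)
Lemma periodic_sum_bounded (f : nat -> R) M : (0 < M)%N ->
  (forall n, f (n %% M)%N = f n) -> (forall n, `|f n| <= 1) ->
  \sum_(i < M) f i = 0 -> forall n, `|\sum_(1 <= i < n) f i| <= M%:R + 1.
Proof.
move=> M_gt0 fM f1 f0 n.
have per k : \sum_(0 <= i < k * M) f i = 0.
  elim: k => [|k IH]; first by rewrite mul0n big_geq.
  rewrite mulSn addnC (big_cat_nat (n := (k * M)%N)) //= ?leq_addr // IH add0r.
  rewrite -{1}[(k * M)%N]add0n big_addn addKn big_mkord -[RHS]f0; apply: eq_bigr => i _.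
  by rewrite -fM addnC modnMDl fM.
have all_n m : `|\sum_(0 <= i < m) f i| <= M%:R.
  rewrite (big_cat_nat (n := (m %/ M * M)%N)) //= ?leq_trunc_div // per add0r.
  apply: le_trans (ler_norm_sum _ _ _) _.
  apply: (@le_trans _ _ (\sum_(m %/ M * M <= i < m) 1)); first exact: ler_sum.
  rewrite sumr_const_nat ler_nat {1}(divn_eq m M) addKn ltnW // ltn_mod //.
case: n => [|n]; first by rewrite big_geq // normr0 addr_ge0.
have := all_n n.+1; rewrite big_nat_recl // -(big_add1 _ _ 0 n.+1 predT) /=.
move=> le1; rewrite -[X in `|X|](addKr (f 0%N)) addrC.
by apply: le_trans (ler_normD _ _) _; rewrite normrN lerD.
Qed.

(** Multiplication by n0 permutes the residues mod M and changes the sign of f. *)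
Lemma multiplicative_sum0 (f : nat -> R) M n0 : (0 < M)%N -> coprime n0 M ->
  (forall n, f (n %% M)%N = f n) -> (forall m n, f (m * n)%N = f m * f n) ->
  f n0 = -1 -> \sum_(i < M) f i = 0.
Proof.
move=> M_gt0 cop fM fMul fn0.
pose h (i : 'I_M) := Ordinal (ltn_pmod (n0 * i) M_gt0).
have h_inj : injective h.
  move=> i j /(congr1 val) /= /eqP; wlog le_ij : i j / (i <= j)%N => [wl|].
    by case: (leqP i j) => [/wl //|/ltnW le_ji]; rewrite eq_sym => /(wl _ _ le_ji) ->.
  rewrite eq_sym eqn_mod_dvd ?leq_mul2l ?le_ij ?orbT // -mulnBr Gauss_dvdr 1?coprime_sym // => M_dvd.
  apply/val_inj/eqP; rewrite eqn_leq le_ij /= -subn_eq0; move: M_dvd.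
  have : (j - i < M)%N by apply: leq_ltn_trans (leq_subr _ _) (ltn_ord j).
  by case: (j - i)%N => // d dM /(dvdn_leq (ltn0Sn d)); rewrite leqNgt dM.
have : \sum_(i < M) f i = - \sum_(i < M) f i.
  rewrite {1}(reindex_inj h_inj) /= -sumrN; apply: eq_bigr => i _.
  by rewrite fM fMul fn0 mulN1r.
lra.
Qed.

Variables (I : finType) (psi : I -> nat -> R).
Hypotheses (psi1 : forall i, psi i 1 = 1).
Hypotheses (psiM : forall i m n, psi i (m * n)%N = psi i m * psi i n).
Hypothesis psi_sign : forall i n, psi i n \in [:: 0; 1; -1].

Let prod_sign (J : {set I}) n : \prod_(i in J) psi i n \in [:: 0; 1; -1].
Proof.
elim/big_ind: _ => // [|x y]; first by rewrite !inE eqxx orbT.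
rewrite !inE => /or3P[] /eqP-> /or3P[] /eqP->;
  by rewrite ?mul0r ?mulr0 ?mul1r ?mulr1 ?mulrNN ?mulr1 ?eqxx ?orbT.
Qed.

(** For a prime p > M the product of the factors e(i) psi(i)(p) + 1 vanishes unless all signs are as
    prescribed. Expanded over subsets J and weighted by ln p / p, it gives a divergent sum for the
    empty J and bounded sums for the others, products of the psi(i) being again real characters. *)
Lemma prime_prescribed_signs (e : I -> R) M :
  (forall J : {set I}, J != finset.set0 -> exists B, forall n,
      `|\sum_(1 <= j < n) \prod_(i in J) psi i j| <= B) ->
  (forall i, e i \in [:: 1; -1]) ->
  (forall i p, prime p -> (M < p)%N -> psi i p != 0) ->
  exists p, [/\ prime p, (M < p)%N & forall i, psi i p = e i].
Proof.
move=> psiB e_sign psi_neq0; apply: contrapT => /forallNP noP.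
pose w p : R := ln p%:R / p%:R.
have w_ge0 p : 0 <= w p by rewrite mulr_ge0 ?invr_ge0 ?lnn_ge0.
have [C CP] : exists C : {set I} -> R, forall J, J != finset.set0 -> forall N,
    `|\sum_(0 <= p < N.+1 | prime p) \prod_(i in J) psi i p * w p| <= C J.
  apply: (@fin_all_exists {set I} (fun=> R) (fun J c => J != finset.set0 -> forall N,
    `|\sum_(0 <= p < N.+1 | prime p) \prod_(i in J) psi i p * w p| <= c)) => J.
  have [->|J0] := eqVneq J finset.set0; first by exists 0.
  have [B BP] := psiB _ J0.
  have [||c cP] := sum_chi_primes_bounded _ _ (prod_sign J) BP; last by exists c.
  - by rewrite big1.
  - by move=> m n; rewrite -big_split /=; apply: eq_bigr => i _; rewrite psiM.
pose ind p := \prod_i (e i * psi i p + 1).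
have ind_eq0 p : prime p -> (M < p)%N -> ind p = 0.
  move=> p_pr Mp; have : ~ forall i, psi i p = e i.
    by move=> ep; apply: (noP p); split.
  move=> /existsNP[i /eqP ne]; rewrite /ind (bigD1 i) //=.
  suff -> : e i * psi i p + 1 = 0 by rewrite mul0r.
  have := psi_sign i p; have := psi_neq0 i p p_pr Mp; have := e_sign i; move: ne.
  rewrite !inE => ne /orP[] /eqP ei p0 /or3P[] /eqP pi; move: ne p0; rewrite ei pi ?eqxx // => _ _;
    by rewrite ?mul1r ?mulr1 ?subrr ?addNr.
pose K := \sum_(0 <= p < M.+1 | prime p) `|w p * ind p|.
have indK N : \sum_(0 <= p < N.+1 | prime p) w p * ind p <= K.
  have h0 p : 0 <= (if prime p then `|w p * ind p| else 0) by case: ifP.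
  have [NM|/ltnW MN] := leqP N M.
    rewrite /K big_mkcond [leRHS]big_mkcond; apply: le_trans (ler_sum_nat_widen 0 (_ : N < M.+1)%N h0) => //.
    by apply: ler_sum => p _; case: ifP => // _; rewrite ler_norm.
  rewrite (big_cat_nat (n := M.+1)) //= [X in _ + X]big_nat_cond [X in _ + X]big1 ?addr0.
    by apply: ler_sum => p _; rewrite ler_norm.
  by move=> p /andP[/andP[Mp _] p_pr]; rewrite ind_eq0 ?mulr0.
have indE N : \sum_(0 <= p < N.+1 | prime p) w p * ind p =
  \sum_(0 <= p < N.+1 | prime p) w p +
  \sum_(J : {set I} | J != finset.set0) (\prod_(i in J) e i) *
     \sum_(0 <= p < N.+1 | prime p) \prod_(i in J) psi i p * w p.
  have expand p : w p * ind p = \sum_(J : {set I}) (\prod_(i in J) e i) * (\prod_(i in J) psi i p * w p).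
    rewrite /ind bigA_distr mulr_sumr; apply: eq_bigr => J _.
    by rewrite -big_mkcond big_split /=; ring.
  rewrite (eq_bigr _ (fun p _ => expand p)) exchange_big /= (bigD1 finset.set0) //=; congr (_ + _).
    by apply: eq_bigr => p _; rewrite !finset.big_set0 !mul1r.
  by apply: eq_bigr => J _; rewrite mulr_sumr.
have [N NP] := sum_lnn_over_prime_unbounded (K + \sum_(J : {set I} | J != finset.set0) C J).
have := indK N; rewrite indE -/w.
have : - \sum_(J : {set I} | J != finset.set0) C J <= \sum_(J : {set I} | J != finset.set0) (\prod_(i in J) e i) *
     \sum_(0 <= p < N.+1 | prime p) \prod_(i in J) psi i p * w p.
  rewrite -sumrN; apply: ler_sum => J J0.
  have := CP J J0 N; have : `|\prod_(i in J) e i| = 1.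
    rewrite normr_prod big1 // => i _; have := e_sign i.
    by rewrite !inE => /orP[] /eqP->; rewrite ?normrN normr1.
  move: (\prod_(i in J) e i) (\sum_(_ <= _ < _ | _) _) => x y x1 yC.
  have : `|x * y| <= C J by rewrite normrM x1 mul1r.
  by rewrite ler_norml => /andP[].
by move: NP; rewrite -/w; lra.
Qed.
End PrescribedSigns.

(** * The characters mod 4, mod 8 and mod odd primes, and their independence *)

Definition chi4 (n : nat) : int := nth 0 [:: 0; 1; 0; -1] (n %% 4).
(** The Jacobi symbol (2/n), as [chi4] is (-1/n); both are tabulated so that their laws can be
    checked by cases. *)
Definition chi8 (n : nat) : int := nth 0 [:: 0; 1; 0; -1; 0; -1; 0; 1] (n %% 8).

Lemma chi4M : {morph chi4 : m n / (m * n)%N >-> m * n}.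
Proof.
move=> m n; rewrite /chi4 -modnMml -modnMmr.
have := ltn_pmod m (isT : 0 < 4)%N; have := ltn_pmod n (isT : 0 < 4)%N.
by move: (m %% 4)%N (n %% 4)%N; do 4?[case=> [|]//]; do 4?[case=> [|]//].
Qed.

Lemma chi8M : {morph chi8 : m n / (m * n)%N >-> m * n}.
Proof.
move=> m n; rewrite /chi8 -modnMml -modnMmr.
have := ltn_pmod m (isT : 0 < 8)%N; have := ltn_pmod n (isT : 0 < 8)%N.
by move: (m %% 8)%N (n %% 8)%N; do 8?[case=> [|]//]; do 8?[case=> [|]//].
Qed.

Lemma chi4_sign n : chi4 n \in [:: 0; 1; -1].
Proof.
rewrite /chi4; have := ltn_pmod n (isT : 0 < 4)%N.
by move: (n %% 4)%N; do 4?[case=> [|]//].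
Qed.

Lemma chi8_sign n : chi8 n \in [:: 0; 1; -1].
Proof.
rewrite /chi8; have := ltn_pmod n (isT : 0 < 8)%N.
by move: (n %% 8)%N; do 8?[case=> [|]//].
Qed.

Lemma chi4_neq0 n : odd n -> chi4 n != 0.
Proof.
rewrite /chi4 -(@odd_mod n 4) //; have := ltn_pmod n (isT : 0 < 4)%N.
by move: (n %% 4)%N; do 4?[case=> [|]//].
Qed.

Lemma chi8_neq0 n : odd n -> chi8 n != 0.
Proof.
rewrite /chi8 -(@odd_mod n 8) //; have := ltn_pmod n (isT : 0 < 8)%N.
by move: (n %% 8)%N; do 8?[case=> [|]//].
Qed.

Lemma chi4_eq1 n : chi4 n = 1 -> (n %% 4 = 1)%N.
Proof.
rewrite /chi4; have := ltn_pmod n (isT : 0 < 4)%N.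
by move: (n %% 4)%N; do 4?[case=> [|]//].
Qed.

Lemma chi8_modn4 n : (n %% 4 = 1)%N -> chi8 n = if (n %% 8 == 1)%N then 1 else -1.
Proof.
rewrite /chi8 -(@modn_dvdm 8 n 4) //; have := ltn_pmod n (isT : 0 < 8)%N.
by move: (n %% 8)%N; do 8?[case=> [|]//].
Qed.

(* Index 0 stands for the nontrivial character mod 4 and index 2 for p |-> (2/p). *)
Definition base_char (q n : nat) : int :=
  if q == 0%N then chi4 n else if q == 2%N then chi8 n else legendre q n.

Section BaseCharacters.
Variable X : nat.

Definition odd_primes_to := [seq q <- iota 3 X | prime q].
Definition base_indices : seq nat := [:: 0%N, 2%N & odd_primes_to].
Definition base_modulus : nat := (8 * \prod_(q <- odd_primes_to) q)%N.

Lemma odd_primes_toP q : q \in odd_primes_to -> [/\ prime q, odd q & q \notin [:: 0; 2]%N].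
Proof.
rewrite mem_filter mem_iota => /and3P[q_pr q3 _]; split=> //.
  by case: (even_prime q_pr) => // q2; rewrite q2 in q3.
by rewrite !inE; case: q q3 {q_pr} => [|[|[|]]].
Qed.

Lemma base_char_odd q : q \in odd_primes_to -> base_char q =1 legendre q.
Proof.
move=> /odd_primes_toP[_ _]; rewrite !inE negb_or /base_char => /andP[/negPf-> /negPf->] n.
by [].
Qed.

Lemma base_char_props i : i \in base_indices ->
  [/\ base_char i 1 = 1, {morph base_char i : m n / (m * n)%N >-> m * n} &
      forall n, base_char i n \in [:: 0; 1; -1]].
Proof.
rewrite !in_cons => /or3P[/eqP->|/eqP->|i_odd].
- by split; [|exact: chi4M|exact: chi4_sign].
- by split; [|exact: chi8M|exact: chi8_sign].
have [i_pr i_od _] := odd_primes_toP i_odd.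
split=> [|m n|n]; rewrite !base_char_odd // ?legendre1 ?legendreM //.
by rewrite /legendre qchar_sign.
Qed.

Lemma base_modulus_gt0 : (0 < base_modulus)%N.
Proof.
rewrite muln_gt0 /= big_seq prodn_cond_gt0 // => q /odd_primes_toP[/prime_gt0 q_gt0 _ _].
exact: q_gt0.
Qed.

(** A single modulus 8 for both indices 0 and 2 keeps distinct moduli coprime, as the Chinese
    remainder theorem requires. *)
Definition base_mod (i : nat) : nat := if i \in [:: 0; 2]%N then 8%N else i.

Lemma base_char_mod i n : i \in base_indices ->
  base_char i (n %% base_mod i)%N = base_char i n.
Proof.
rewrite !in_cons => /or3P[/eqP->|/eqP->|i_odd].
- by rewrite /base_char /= /chi4 modn_dvdm.
- by rewrite /base_char /= /chi8 modn_mod.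
have [i_pr _ /negPf i02] := odd_primes_toP i_odd.
by rewrite /base_mod i02 !base_char_odd // legendre_mod.
Qed.

Lemma base_char_cong i m n : i \in base_indices -> m = n %[mod base_mod i] ->
  base_char i m = base_char i n.
Proof. by move=> iI e; rewrite -(base_char_mod m iI) e base_char_mod. Qed.

Lemma base_mod_dvd i : i \in base_indices -> (base_mod i %| base_modulus)%N.
Proof.
rewrite !in_cons => /or3P[/eqP->|/eqP->|i_odd]; [exact: dvdn_mulr|exact: dvdn_mulr|].
have [i_pr _ /negPf i02] := odd_primes_toP i_odd.
by rewrite /base_mod i02 /base_modulus dvdn_mull // (big_rem i) // dvdn_mulr.
Qed.

(** Independence of the base characters: a product over a nonempty set of indices takes the value -1
    at the n0 of any of its members, so its sum over a period is 0. The Chinese remainder theorem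
    supplies n0. *)
Lemma base_char_cond i : i \in base_indices ->
  exists n0, [/\ coprime n0 base_modulus, base_char i n0 = -1 &
    forall j, j \in base_indices -> j != i -> base_char j n0 = 1].
Proof.
have char1 j : j \in base_indices -> base_char j 1 = 1 by case/base_char_props.
pose P := (\prod_(q <- odd_primes_to) q)%N.
have cop8 q : q \in odd_primes_to -> coprime 8 q.
  by case/odd_primes_toP => _ q_odd _; rewrite (@coprime_pexpl 3 2) // coprime2n.
have cop8P : coprime 8 P.
  by rewrite /P big_seq; elim/big_ind: _ => [|x y cx cy|q]; [exact: coprimen1|rewrite coprimeMr cx|exact: cop8].
have even_case r a : coprime r 8 -> base_char i r = -1 -> a = chinese 8 P r 1 ->
    (forall j, j \in [:: 0; 2]%N -> j != i -> base_char j r = 1) -> i \in [:: 0; 2]%N ->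
  exists n0, [/\ coprime n0 base_modulus, base_char i n0 = -1 &
    forall j, j \in base_indices -> j != i -> base_char j n0 = 1].
  move=> cop_r ir aE other i02.
  have a8 : a = r %[mod 8] by rewrite aE chinese_modl.
  have aP : a = 1 %[mod P] by rewrite aE chinese_modr.
  have small j : j \in [:: 0; 2]%N -> j \in base_indices /\ base_mod j = 8%N.
    by rewrite /base_mod => j02; rewrite j02 !inE; move: j02; rewrite !inE => /orP[]->; rewrite ?orbT.
  exists a; split.
  - rewrite coprimeMr -(coprime_modl a 8) a8 coprime_modl cop_r.
    by rewrite -coprime_modl aP coprime_modl coprime1n.
  - by have [iI i8] := small i i02; rewrite -ir; apply: (base_char_cong iI); rewrite i8.
  - move=> j jI ji; case: (boolP (j \in [:: 0; 2]%N)) => j02.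
      have [_ j8] := small j j02.
      by rewrite -(other j j02 ji); apply: (base_char_cong jI); rewrite j8.
    rewrite -(char1 j jI); apply: (base_char_cong jI); rewrite /base_mod (negPf j02).
    have jP : (j %| P)%N.
      rewrite /P (big_rem j) ?dvdn_mulr //.
      by move: jI j02; rewrite !in_cons !in_nil orbF negb_or => /or3P[->|->|] //; rewrite ?andbF.
    by rewrite -(modn_dvdm _ jP) aP modn_dvdm.
rewrite !in_cons => /or3P[/eqP i0|/eqP i2|i_odd].
(* 7 is -1 mod 4 and (2/7) = 1; in the next case 5 is 1 mod 4 and (2/5) = -1. *)
- apply: (even_case 7%N _ _ _ erefl); rewrite ?i0 // => j.
  by rewrite !inE => /orP[] /eqP->.
- apply: (even_case 5%N _ _ _ erefl); rewrite ?i2 // => j.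
  by rewrite !inE => /orP[] /eqP->.
have [i_pr i_od i02] := odd_primes_toP i_odd.
have [a aN] := legendre_nonresidue i_pr i_od.
pose Q := (8 * \prod_(q <- rem i odd_primes_to) q)%N.
have MQ : base_modulus = (i * Q)%N by rewrite /base_modulus (big_rem i) //= mulnCA.
have uniq_odd : uniq odd_primes_to by rewrite filter_uniq ?iota_uniq.
have copQ : coprime i Q.
  rewrite coprimeMr coprime_sym cop8 //= big_seq.
  elim/big_ind: _ => [|x y cx cy|q]; [exact: coprimen1|by rewrite coprimeMr cx|].
  rewrite mem_rem_uniq // inE => /andP[qi /odd_primes_toP[q_pr _ _]].
  by rewrite prime_coprime // dvdn_prime2 // eq_sym.
have mi : base_mod i = i by rewrite /base_mod (negPf i02).
have iI : i \in base_indices by rewrite !in_cons i_odd !orbT.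
exists (chinese i Q a 1); split.
- rewrite MQ coprimeMr -coprime_modl chinese_modl // coprime_modl.
  rewrite -(coprime_modl _ Q) chinese_modr // coprime_modl coprime1n andbT.
  by rewrite coprime_sym prime_coprime // -legendre_eq0 // aN.
- by rewrite -aN -(base_char_odd i_odd); apply: (base_char_cong iI); rewrite mi chinese_modl.
move=> j jI ji; rewrite -(char1 j jI); apply: (base_char_cong jI).
have jQ : (base_mod j %| Q)%N.
  rewrite /base_mod; case: ifP => j02; first exact: dvdn_mulr.
  rewrite /Q dvdn_mull // (big_rem j) ?dvdn_mulr //= mem_rem_uniq // inE ji.
  by move: jI j02; rewrite !in_cons !in_nil orbF => /or3P[->|->|] //; rewrite ?orbT.
by rewrite -(modn_dvdm _ jQ) chinese_modr // modn_dvdm.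
Qed.
End BaseCharacters.

(** Prescribing the value 1 at index 0 makes p = 1 mod 4; then (2/p) is given by [chi8], and (q/p) =
    (p/q) by reciprocity, so prescribed base characters become prescribed Legendre symbols. *)
Lemma exists_prime_legendre (R : realType) X N (e : nat -> int) :
  (forall q, e q \in [:: 1; -1]) ->
  exists p, [/\ prime p, (N < p)%N, (p %% 4 = 1)%N &
    forall q, prime q -> (q < X)%N -> legendre p q = e q].
Proof.
move=> e_sign.
pose I := seq_sub (base_indices X).
pose psi (i : I) n : R := (base_char (ssval i) n)%:~R.
pose e' (i : I) : R := if ssval i == 0%N then 1 else (e (ssval i))%:~R.
have M_gt0 := base_modulus_gt0 X.
have psi_in (i : I) : ssval i \in base_indices X := ssvalP i.
have e'_sign i : e' i \in [:: 1; -1].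
  rewrite /e'; case: eqP => _; first by rewrite inE eqxx.
  have := e_sign (ssval i).
  by rewrite !inE => /orP[] /eqP->; rewrite ?mulrN1z eqxx ?orbT.
have psi1 i : psi i 1 = 1 by have [c1 _ _] := base_char_props (psi_in i); rewrite /psi c1.
have psiM i m n : psi i (m * n)%N = psi i m * psi i n.
  by have [_ cM _] := base_char_props (psi_in i); rewrite /psi cM intrM.
have psi_sign i n : psi i n \in [:: 0; 1; -1].
  have [_ _ /(_ n)] := base_char_props (psi_in i); rewrite /psi !inE.
  by move=> /or3P[] /eqP->; rewrite ?mulrN1z eqxx ?orbT.
have psi_mod i n : psi i (n %% base_modulus X)%N = psi i n.
  rewrite /psi; congr (_%:~R); apply: (base_char_cong (psi_in i)).
  by rewrite modn_dvdm // base_mod_dvd ?psi_in.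
have psiB (J : {set I}) : J != finset.set0 -> exists B : R, forall n,
    `|\sum_(1 <= j < n) \prod_(i in J) psi i j| <= B.
  move=> /set0Pn[i iJ]; have [n0 [cop i0 j0]] := base_char_cond (psi_in i).
  exists ((base_modulus X)%:R + 1); apply: (periodic_sum_bounded M_gt0).
  - by move=> n; apply: eq_bigr => j _; rewrite psi_mod.
  - move=> n; elim/big_ind: _ => [|x y x1 y1|j _]; [by rewrite normr1|by rewrite normrM mulr_ile1|].
    by have := psi_sign j n; rewrite !inE => /or3P[] /eqP->; rewrite ?normr0 ?normrN ?normr1.
  apply: (@multiplicative_sum0 R (fun j => \prod_(k in J) psi k j) _ n0 M_gt0 cop).
  - by move=> n; apply: eq_bigr => j _; rewrite psi_mod.
  - by move=> m n; rewrite -big_split; apply: eq_bigr => j _; rewrite psiM.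
  rewrite (bigD1 i) //= {1}/psi i0 mulrN1z big1 ?mulr1 // => j /andP[_ ji].
  have ji' : ssval j != ssval i by apply: contraNneq ji => /val_inj->.
  by rewrite /psi (j0 _ (psi_in j) ji').
(* Beyond N + X + 2 a prime is odd and larger than every index, so no base character vanishes at
   it. *)
have psi_neq0 i p : prime p -> (N + X + 2 < p)%N -> psi i p != 0.
  move=> p_pr p_gt; rewrite /psi intr_eq0.
  have p_odd : odd p by case: (even_prime p_pr) => // p2; move: p_gt; rewrite p2; lia.
  have := psi_in i; rewrite !in_cons => /or3P[/eqP->|/eqP->|i_odd].
  - by rewrite /base_char /= chi4_neq0.
  - by rewrite /base_char /= chi8_neq0.
  have [i_pr i_od _] := odd_primes_toP i_odd.
  rewrite (base_char_odd i_odd) legendre_eq0 // dvdn_prime2 //.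
  apply: contraTneq p_gt => <-; rewrite -leqNgt.
  by move: i_odd; rewrite mem_filter mem_iota => /and3P[_ _]; lia.
have [p [p_pr p_gt pE]] := prime_prescribed_signs psi1 psiM psi_sign psiB e'_sign psi_neq0.
have base_val i : i \in base_indices X -> (base_char i p)%:~R = (if i == 0%N then 1 else (e i)%:~R : R).
  by move=> iI; exact: pE (SeqSub iI).
have p4 : (p %% 4 = 1)%N.
  have := base_val 0%N; rewrite !inE => /(_ isT) /=; rewrite /base_char /= -[1]/(1%:~R).
  by move=> /intr_inj; exact: chi4_eq1.
exists p; split=> //; first by lia.
move=> q q_pr qX; have [q2|q_odd] := even_prime q_pr.
  have := base_val 2%N; rewrite !inE orbT => /(_ isT) /=; rewrite /base_char /= q2 => /intr_inj <-.
  by rewrite legendre2 // chi8_modn4.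
have q_in : q \in odd_primes_to X.
  rewrite mem_filter q_pr mem_iota; have := odd_prime_gt2 q_odd q_pr; lia.
have pq : p != q by apply: contraTneq p_gt => ->; rewrite -leqNgt; lia.
rewrite quadratic_reciprocity1 // -(base_char_odd q_in).
have := base_val q; rewrite !in_cons q_in !orbT => /(_ isT).
have [_ _] := odd_primes_toP q_in; rewrite !inE negb_or => /andP[/negPf-> _].
exact: intr_inj.
Qed.

(** * Irreducible polynomials over F_2 *)

(** The polynomial is the minimal polynomial of x over the base field, pulled back to coefficients
    in F. *)
Lemma exists_irreducible_root (F : fieldType) (L : fieldExtType F) (x : L) :
  exists q : {poly F}, [/\ irreducible_poly q, (size q <= (\dim {:L}).+1)%N &
    root (map_poly (in_alg L) q) x].
Proof.
have /polyOver1P[q qE] := minPolyOver 1%AS x.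
have szE : size q = size (minPoly 1%AS x) by rewrite qE size_map_poly.
exists q; split.
- split; first by rewrite szE size_minPoly ltnS.
  move=> p p1 pq.
  have : map_poly (in_alg L) p %| minPoly 1%AS x by rewrite qE dvdp_map.
  have p_over : map_poly (in_alg L) p \is a polyOver 1%VS by apply/polyOver1P; exists p.
  move=> /(minPoly_irr p_over) /orP[|]; first by rewrite qE eqp_map.
  by move/eqp_size; rewrite size_map_poly size_poly1 => /eqP; rewrite (negPf p1).
- rewrite szE size_minPoly ltnS adjoin_degreeE dimv1 divn1.
  by rewrite dimvS ?subvf.
by rewrite -qE root_minPoly.
Qed.

Section IrreducibleCount.
Local Notation F2 := 'F_2.

(* 'X is excluded because its logarithmic derivative has a pole at 0. *)
Definition irr_level d : seq {poly F2} :=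
  [seq p : {poly F2} <- [seq rVpoly v | v <- enum {: 'rV[F2]_d.+1}] |
    [&& size p == d.+1, `[< irreducible_poly p >] & p != 'X]].

(** Ordered by degree, so that each list is a prefix of the longer ones and a position names the
    same polynomial in all of them. *)
Fixpoint irr_upto d := if d is d'.+1 then irr_upto d' ++ irr_level d else [::].

Lemma mem_irr_level d (p : {poly F2}) : reflect [/\ irreducible_poly p, size p = d.+1 & p != 'X]
  (p \in irr_level d).
Proof.
rewrite mem_filter; apply: (iffP andP) => [[/and3P[/eqP szp /asboolP irr pX] _]|[irr szp pX]].
  by split.
split; first by rewrite szp eqxx pX andbT; apply/asboolP.
by apply/mapP; exists (poly_rV p); rewrite ?mem_enum // poly_rV_K ?szp.
Qed.

Lemma mem_irr_upto d (p : {poly F2}) : reflect [/\ irreducible_poly p, (size p <= d.+1)%N & p != 'X]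
  (p \in irr_upto d).
Proof.
elim: d => [|d IH] /=.
  by rewrite in_nil; constructor => -[[p1 _] p1' _]; rewrite ltnNge p1' in p1.
rewrite mem_cat; apply: (iffP orP) => [[/IH[irr szp pX]|/mem_irr_level[irr szp pX]]|[irr]].
- by split=> //; apply: leqW.
- by split=> //; rewrite szp.
rewrite leq_eqVlt => /orP[/eqP szp|szp] pX; last by left; apply/IH.
by right; apply/mem_irr_level.
Qed.

Lemma uniq_irr_upto d : uniq (irr_upto d).
Proof.
elim: d => //= d IH; rewrite cat_uniq IH filter_uniq ?andbT /=; last first.
  by rewrite map_inj_uniq ?enum_uniq //; apply: can_inj rVpolyK.
apply/hasPn => p /mem_irr_level[_ szp _]; apply/negP => /mem_irr_upto[_].
by rewrite szp ltnn.
Qed.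

Lemma irr_upto_cat d e : exists s, irr_upto (d + e) = irr_upto d ++ s.
Proof.
elim: e => [|e [s sE]]; first by exists [::]; rewrite addn0 cats0.
by exists (s ++ irr_level (d + e.+1)); rewrite addnS /= sE catA.
Qed.

(* Every element of the field with 2^d elements is a root of 'X or of a listed polynomial, and
   each of these has at most d roots. *)
Lemma size_irr_upto d : (0 < d)%N -> (2 ^ d <= d * (size (irr_upto d)).+1)%N.
Proof.
move=> d_gt0; have [L0 pcharL cardL] := pPrimePowerField (isT : prime 2) d_gt0.
pose L : splittingFieldType F2 := pPrimeCharType pcharL.
have dimL : \dim {:L} = d by rewrite pprimeChar_dimf cardL pfactorK.
pose Z p : {set L0} := finset (fun x : L0 => root (map_poly (in_alg L) p) (x : L)).
have in_flat x : x \in flatten [seq enum (Z p) | p <- 'X :: irr_upto d].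
  have [q [irr szq qx]] := exists_irreducible_root (x : L).
  apply/flatten_mapP; exists q; last by rewrite mem_enum inE.
  rewrite in_cons; case: eqP => //= /eqP qX; apply/mem_irr_upto.
  by rewrite -dimL.
have := uniq_leq_size (enum_uniq L0) (fun x _ => in_flat x).
rewrite -cardE cardL => /leq_trans; apply.
rewrite size_flatten /shape -map_comp sumnE big_map.
apply: (@leq_trans (\sum_(p <- 'X :: irr_upto d) d)); last first.
  by rewrite big_const_seq count_predT iter_addn_0.
rewrite big_seq [leqRHS]big_seq; apply: leq_sum => p p_in /=.
have [p0 szp] : p != 0 /\ (size p <= d.+1)%N.
  move: p_in; rewrite in_cons => /orP[/eqP->|/mem_irr_upto[irr szp _]].
    by rewrite polyX_eq0 size_polyX.
  by split=> //; apply: irredp_neq0.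
rewrite -ltnS; apply: leq_trans szp; rewrite -(size_map_poly (in_alg L)).
apply: (@max_poly_roots L); rewrite ?map_poly_eq0 ?enum_uniq //.
by apply/allP => x; rewrite mem_enum inE.
Qed.

(** Primes and polynomials are matched by position. For j = floor(log2 q) there are at most 6 *
    2^(j+1)/(j+1) primes up to 2^(j+1), and at least 2^(j+6)/(j+6) - 1 listed polynomials of degree
    at most j + 6. The shift 6 suffices because 64 (j + 1) > 12 (j + 6) for j >= 1, and 2^(j+6) <=
    64 q. *)
Lemma prime_irreducible_injection n : exists P : nat -> {poly F2},
  (forall q, prime q -> (q < 2 ^ n)%N ->
     [/\ irreducible_poly (P q), P q != 'X & (2 ^ (size (P q)).-1 <= 64 * q)%N]) /\
  (forall q q', prime q -> prime q' -> (q < 2 ^ n)%N -> (q' < 2 ^ n)%N ->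
     P q = P q' -> q = q').
Proof.
pose idx q := count prime (iota 0 q).
pose P q := nth 0 (irr_upto (n + 6)) (idx q).
have idx_mono q q' : prime q -> (q < q')%N -> (idx q < idx q')%N.
  move=> q_pr qq'; rewrite /idx -(subnKC qq') iotaD count_cat.
  by rewrite -(addn1 q) iotaD count_cat /= add0n q_pr; lia.
have idx_lt q : prime q -> (idx q < size (irr_upto (trunc_log 2 q + 6)))%N.
  move=> q_pr; set j := trunc_log 2 q.
  have j_gt0 : (0 < j)%N by rewrite trunc_log_gt0 /= prime_gt1.
  have lt_q : (q < 2 ^ j.+1)%N by apply: trunc_log_ltn.
  have le_pi : (idx q < prime_pi (2 ^ j.+1))%N by exact: (idx_mono _ (2 ^ j.+1).+1 q_pr (leqW lt_q)).
  have pi_ub := prime_pi_ub j.+1.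
  have szI := @size_irr_upto (j + 6) _; rewrite addnS ltn0Sn in szI.
  have {}szI := szI isT; rewrite -addnS in szI.
  rewrite ltnNge; apply/negP => le_idx.
  have le2 : ((size (irr_upto (j + 6))).+1 <= prime_pi (2 ^ j.+1))%N by apply: leq_ltn_trans le_pi.
  have : (j.+1 * 2 ^ (j + 6) <= (j + 6) * (6 * 2 ^ j.+1))%N.
    apply: (@leq_trans (j.+1 * ((j + 6) * prime_pi (2 ^ j.+1)))).
      by rewrite leq_mul2l /=; apply: leq_trans szI _; rewrite leq_mul2l le2 orbT.
    by rewrite mulnCA leq_mul2l pi_ub orbT.
  have x_gt0 : (0 < 2 ^ j)%N by rewrite expn_gt0.
  have -> : (j.+1 * 2 ^ (j + 6) = 2 ^ j * (64 * j.+1))%N by rewrite expnD -[(2 ^ 6)%N]/64%N; ring.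
  have -> : ((j + 6) * (6 * 2 ^ j.+1) = 2 ^ j * (12 * (j + 6)))%N by rewrite expnS; ring.
  by rewrite leq_pmul2l //; clear -j_gt0; lia.
have lt_log q : prime q -> (q < 2 ^ n)%N -> (trunc_log 2 q < n)%N.
  move=> q_pr qn; rewrite -(@ltn_exp2l 2) //; apply: leq_ltn_trans qn.
  exact: trunc_logP (prime_gt0 q_pr).
have PE q : prime q -> (q < 2 ^ n)%N ->
    (idx q < size (irr_upto (n + 6)))%N /\ P q \in irr_upto (trunc_log 2 q + 6).
  move=> q_pr qn; have lt_j := lt_log q q_pr qn; have i_lt := idx_lt q q_pr.
  have [s sE] := irr_upto_cat (trunc_log 2 q + 6) (n - trunc_log 2 q).
  have {}sE : irr_upto (n + 6) = irr_upto (trunc_log 2 q + 6) ++ s.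
    by rewrite -sE; congr irr_upto; lia.
  by rewrite /P sE size_cat nth_cat i_lt mem_nth // ltn_addr.
exists P; split=> [q q_pr qn|q q' q_pr q'_pr qn q'n].
  have [_ /mem_irr_upto[irr szP PX]] := PE q q_pr qn; split=> //.
  apply: (@leq_trans (2 ^ (trunc_log 2 q + 6))); first by rewrite leq_exp2l //; lia.
  by rewrite expnD mulnC leq_mul2l trunc_logP // prime_gt0.
have [i_q _] := PE q q_pr qn; have [i_q' _] := PE q' q'_pr q'n.
move=> /eqP; rewrite nth_uniq ?uniq_irr_upto // => /eqP eq_idx.
case: (ltngtP q q') => // lt_q.
  by have := idx_mono q q' q_pr lt_q; rewrite eq_idx ltnn.
by have := idx_mono q' q q'_pr lt_q; rewrite eq_idx ltnn.
Qed.

End IrreducibleCount.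

(** * Logarithmic derivatives over F_2 *)

Section LogDerivative.
Local Notation F2 := 'F_2.
Local Notation P2 := {poly 'F_2}.

Lemma F2_pchar : 2%N \in [pchar F2]. Proof. exact: pchar_Fp. Qed.

Lemma polyF2_pchar : 2%N \in [pchar P2]. Proof. by rewrite pchar_poly F2_pchar. Qed.

Lemma polyF2_addrr (p : P2) : p + p = 0. Proof. exact: addrr_pchar2 polyF2_pchar p. Qed.

Lemma F2_case (c : F2) : c = 0 \/ c = 1.
Proof. by case: c => [[|[|]]] // i; [left|right]; apply: val_inj. Qed.

Lemma polyF2_mulrn (p : P2) n : p *+ n = if odd n then p else 0.
Proof.
elim: n => // n IH; rewrite mulrS IH oddS.
by case: odd; rewrite /= ?addr0 ?polyF2_addrr.
Qed.

Lemma F2_mulrn (c : F2) n : c *+ n = if odd n then c else 0.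
Proof.
elim: n => // n IH; rewrite mulrS IH oddS.
by case: odd; rewrite /= ?addr0 ?(addrr_pchar2 F2_pchar).
Qed.

Lemma polyF2_sqr_sum (I : Type) (r : seq I) (F : I -> P2) :
  (\sum_(i <- r) F i) ^+ 2 = \sum_(i <- r) F i ^+ 2.
Proof.
elim: r => [|i r IH]; first by rewrite !big_nil expr0n.
by rewrite !big_cons sqrrD IH mulr2n polyF2_addrr addr0.
Qed.

Lemma polyF2_deriv2 (p : P2) : p^`()^`() = 0.
Proof.
apply/polyP => i; rewrite !coef_deriv coef0 -mulrnA F2_mulrn oddM /= andNb.
by [].
Qed.

(** A zero derivative leaves only even exponents, and each coefficient in F_2 is its own square. *)
Lemma polyF2_deriv0_sqr (p : P2) : p^`() = 0 -> exists s, p = s ^+ 2.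
Proof.
move=> p'0; pose s : P2 := \poly_(i < size p) p`_(i.*2).
exists s; have -> : p = s \Po 'X^2.
  apply/polyP => i; rewrite coef_comp_poly_Xn // dvdn2 coef_poly.
  case: (boolP (odd i)) => [i_odd|i_even] /=.
    have := congr1 (fun q : P2 => q`_i.-1) p'0; rewrite coef_deriv coef0.
    by case: i i_odd => // i /= i_odd; rewrite F2_mulrn /= i_odd.
  rewrite divn2 even_halfK //; case: ltnP => // szi.
  rewrite nth_default // (leq_trans szi) //; lia.
rewrite comp_polyE [in RHS](_ : s = \sum_(i < size s) s`_i *: 'X^i); last by rewrite -poly_def coefK.
rewrite polyF2_sqr_sum; apply: eq_bigr => i _.
rewrite exprZn -exprM mulnC exprM; congr (_ *: _).
by case: (F2_case s`_i) => ->; rewrite ?expr0n ?expr1n.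
Qed.

Lemma irredF2_deriv_neq0 (p : P2) : irreducible_poly p -> p^`() != 0.
Proof.
move=> [p1 irr]; apply/eqP => /polyF2_deriv0_sqr[s sE].
have s_dvd : s %| p by rewrite sE expr2 dvdp_mulr.
have s0 : s != 0 by apply: contraTneq p1 => s0; rewrite sE s0 expr0n size_poly0.
have szE : (size p = (size s + size s).-1)%N by rewrite sE expr2 size_mul.
have s_gt0 : (0 < size s)%N by rewrite size_poly_gt0.
have s1 : size s != 1%N by apply: contraTneq p1 => s1; rewrite szE s1.
have := eqp_size (irr s s1 s_dvd); rewrite szE => e.
by move: s1 s_gt0 e; case: (size s) => [|[|n]] //= _ _; lia.
Qed.

Lemma irredF2_coprime (p q : P2) :
  irreducible_poly p -> irreducible_poly q -> p != q -> coprimep p q.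
Proof.
move=> irr_p irr_q pq; rewrite irreducible_poly_coprime //; apply/negP => p_q.
have p1 : size p != 1%N by have := irr_p.1; case: (size p) => [|[|]].
have /eqpP[[a b] /andP[/= a0 b0]] := irr_q.2 p p1 p_q.
case: (F2_case a) (F2_case b) a0 b0 => -> [] -> //=.
by rewrite !scale1r => _ _ /eqP; rewrite (negPf pq).
Qed.

Lemma coprimep_prodF2 (p : P2) s : (forall q, q \in s -> coprimep p q) ->
  coprimep p (\prod_(q <- s) q).
Proof.
elim: s => [|q s IH] sP; first by rewrite big_nil coprimep1.
by rewrite big_cons coprimepMr sP ?mem_head // IH // => r rs; rewrite sP // in_cons rs orbT.
Qed.

(** For a factor p and the product r of the others, (p r)' = 0 gives p | p' r, hence p | p'; but p'
    is nonzero of smaller degree. *)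
Lemma prod_irredF2_deriv_neq0 (s : seq P2) : uniq s -> s != [::] ->
  (forall p, p \in s -> irreducible_poly p) -> (\prod_(p <- s) p)^`() != 0.
Proof.
case: s => // p s /= /andP[p_s _] _ irr; apply/eqP => e.
have irr_p := irr p (mem_head _ _).
have cop : coprimep p (\prod_(q <- s) q).
  apply: coprimep_prodF2 => q qs; apply: irredF2_coprime => //; first by apply: irr; rewrite in_cons qs orbT.
  by apply: contraNneq p_s => ->.
move: e; rewrite big_cons derivM => e.
have : p %| p^`() * \prod_(q <- s) q.
  by rewrite -[X in _ %| X]addr0 -(polyF2_addrr (p * (\prod_(q <- s) q)^`())) addrA e add0r dvdp_mulr.
rewrite mulrC Gauss_dvdpr // => /(dvdp_leq (irredF2_deriv_neq0 irr_p)).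
by rewrite leqNgt lt_size_deriv // irredp_neq0.
Qed.


Lemma dvdp_Xn (F : fieldType) (p : {poly F}) m :
  (forall i, (i < m)%N -> p`_i = 0) -> 'X^m %| p.
Proof.
move=> p0; rewrite -[p](poly_take_drop m) (_ : take_poly m p = 0) ?add0r ?dvdp_mull //.
by apply/polyP => i; rewrite coef_take_poly coef0; case: ifP => // /p0.
Qed.

Section Truncation.
Variable k : nat.
Local Notation m := k.*2.

(** Here u inverts p, so F = p' u is the logarithmic derivative. As p'' = 0, F' = p' u', and
    differentiating p u = 1 turns this into F^2. The exponent m is even, so (w X^m)' = w' X^m is
    still divisible by X^m. *)
Lemma deriv_inverse_riccati (p u : P2) : 'X^m %| p * u - 1 ->
  'X^m %| (p^`() * u)^`() - (p^`() * u) ^+ 2.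
Proof.
case/dvdpP => w /(canRL (subrK _)) pu.
have e : p^`() * u + p * u^`() = w^`() * 'X^m.
  rewrite -derivM pu derivD [(w * _)^`()]derivM -polyC1 derivC derivXn addr0.
  by rewrite polyF2_mulrn odd_double mulr0 addr0.
have -> : (p^`() * u)^`() = p^`() * u^`() by rewrite derivM polyF2_deriv2 mul0r add0r.
have -> : p^`() * u^`() - (p^`() * u) ^+ 2 =
    p^`() * u * (p^`() * u + p * u^`()) - (p * u - 1) * p^`() * u^`()
      - (p^`() * u) ^+ 2 - (p^`() * u) ^+ 2 by ring.
rewrite -addrA -opprD polyF2_addrr subr0 e pu addrK.
rewrite dvdp_sub //; first by rewrite mulrA dvdp_mull.
by rewrite -!mulrA mulrCA dvdp_mulr.
Qed.

(* With all even coefficients of [g] zero, [g = X g'], so [g (1 - X g) = 0] modulo [X^m]. *)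
Lemma riccati_even_coefs0 (g : P2) : 'X^m %| g^`() - g ^+ 2 ->
  (forall j, (j < k)%N -> g`_(j.*2) = 0) -> 'X^m %| g.
Proof.
move=> ric even0.
have gX : 'X^m %| g - 'X * g^`().
  apply: dvdp_Xn => i im; rewrite coefB coefXM coef_deriv.
  case: i im => [|i] im /=; first by rewrite (even0 0%N) ?subr0 //; lia.
  rewrite F2_mulrn; case: (boolP (odd i.+1)) => [_|i_even]; first by rewrite subrr.
  rewrite subr0 -(even_halfK i_even) even0 //; lia.
have : 'X^m %| g * (1 - 'X * g).
  have -> : g * (1 - 'X * g) = (g - 'X * g^`()) + 'X * (g^`() - g ^+ 2) by ring.
  by rewrite dvdp_add // dvdp_mull.
rewrite Gauss_dvdpl // coprimep_expl // (_ : 1 - 'X * g = - g * 'X + 1); last by ring.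
by rewrite coprimep_addl_mul coprimep1.
Qed.

(** For the product r of the list, the sum g of the logarithmic derivatives satisfies r' = r g mod
    X^m. If all digits vanished, then g = 0 mod X^m and X^m would divide r' <> 0, whose degree is
    below deg r <= m. *)
Lemma exists_log_derivative_digits : exists lam : P2 -> 'I_k -> F2,
  forall s : seq P2, uniq s -> s != [::] ->
    (forall p, p \in s -> irreducible_poly p /\ p != 'X) ->
    (size (\prod_(p <- s) p)%R <= m.+1)%N ->
  exists j, \sum_(p <- s) lam p j != 0.
Proof.
have [U UP] : exists U : P2 -> P2, forall p, coprimep p 'X -> 'X^m %| p * U p - 1.
  suff /boolp.choice[U UP] : forall p : P2, exists u : P2, coprimep p 'X -> 'X^m %| p * u - 1 by exists U.
  move=> p; case: (boolP (coprimep p 'X)) => [cop|]; last by exists 0.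
  have /Bezout_eq1_coprimepP[[u v] /= uv] : coprimep p 'X^m by apply: coprimep_expr.
  by exists u => _; rewrite -uv opprD addrA [p * u]mulrC subrr sub0r dvdpNr dvdp_mull.
pose F p := p^`() * U p.
exists (fun p j => (F p)`_(j.*2)) => s s_uniq s_nil s_irr sz.
apply: contrapT => /forallNP all0.
pose g := \sum_(p <- s) F p; pose r := \prod_(p <- s) p.
have copX p : p \in s -> coprimep p 'X.
  move=> /s_irr[irr pX]; apply: irredF2_coprime => //.
  by have := @irredp_XsubC _ (0 : F2); rewrite subr0.
have g_even j : (j < k)%N -> g`_(j.*2) = 0.
  move=> jk; have := all0 (Ordinal jk); rewrite /= => /negP; rewrite negbK => /eqP.
  by rewrite coef_sum.
have g_ric : 'X^m %| g^`() - g ^+ 2.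
  rewrite /g polyF2_sqr_sum raddf_sum -sumrB big_seq.
  elim/big_ind: _ => [|x y x0 y0|p ps]; [exact: dvdp0|exact: dvdp_add|].
  exact: deriv_inverse_riccati (UP p (copX p ps)).
have g0 := riccati_even_coefs0 g_ric g_even.
have r_der : 'X^m %| r^`() - r * g.
  rewrite /r /g; elim: s copX {s_uniq s_nil s_irr sz all0 g r g_even g_ric g0} => [|p s IH] copX.
    by rewrite !big_nil derivC mulr0 subr0 dvdp0.
  rewrite !big_cons derivM.
  set r := \prod_(q <- s) q; set g := \sum_(q <- s) F q.
  have -> : p^`() * r + p * r^`() - p * r * (F p + g) =
     p * (r^`() - r * g) - p^`() * r * (p * U p - 1) by rewrite /F; ring.
  rewrite dvdp_sub // dvdp_mull //; first by apply: IH => q qs; rewrite copX // in_cons qs orbT.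
  by rewrite UP // copX // mem_head.
have r'0 : r^`() != 0 by apply: prod_irredF2_deriv_neq0 => // p /s_irr[].
have r0 : r != 0 by apply: contraNneq r'0 => ->; rewrite deriv0.
have : 'X^m %| r^`() by rewrite -(subrK (r * g) r^`()) dvdp_add // dvdp_mull.
move=> /(dvdp_leq r'0); rewrite size_polyXn => lt_m.
by have := leq_trans (leq_ltn_trans lt_m (lt_size_deriv r0)) sz; rewrite ltnn.
Qed.
End Truncation.
End LogDerivative.

(** * The upper bound *)

Section UpperBound.

Lemma quadratic_residueP n r :
  quadratic_residue n r <-> exists x : int, (n%:Z %| r%:Z - x ^+ 2)%Z.
Proof.
by split=> -[x]; [move/eqP|move=> ?]; exists x; [|apply/eqP]; rewrite ?eqz_mod_dvd // -eqz_mod_dvd.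
Qed.

Lemma quadratic_residue_mul m n r : coprime m n ->
  quadratic_residue m r -> quadratic_residue n r -> quadratic_residue (m * n) r.
Proof.
move=> cop [x xr] [y yr]; apply/quadratic_residueP.
have copz : coprimez m%:Z n%:Z by rewrite coprimezE.
pose z := zchinese m%:Z n%:Z x y; exists z.
rewrite PoszM Gauss_dvdz // -!eqz_mod_dvd; apply/andP; split; apply/eqP.
  by rewrite xr -modzXm -(zchinese_modl copz x y) modzXm.
by rewrite yr -modzXm -(zchinese_modr copz x y) modzXm.
Qed.

(** Newton step: if r = x^2 + c p^e with e >= 1, add c u p^e to x, where u inverts 2x mod p. *)
Lemma hensel_odd p r e : prime p -> odd p -> legendre p r = 1 ->
  quadratic_residue (p ^ e) r.
Proof.
move=> p_pr p_odd r1; case: e => [|e].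
  by apply/quadratic_residueP; exists 0; rewrite expn0 dvd1z.
elim: e => [|e /quadratic_residueP[x xr]]; apply/quadratic_residueP.
  have oddF : odd #|'F_p| by rewrite card_Fp.
  have [y yE] := qchar1_square oddF r1; exists (val y : nat)%:Z.
  have e_r : r%:R = ((val y) ^ 2)%N%:R :> 'F_p by rewrite natrX natr_Zp.
  rewrite expn1 -eqz_mod_dvd -[_ ^+ 2]/((val y ^ 2)%N%:Z) !modz_nat eqz_nat.
  by have := congr1 val e_r; rewrite /= !val_Fp_nat // => ->.
have [c cE] := dvdzP xr.
have copx : coprimez (2 * x) p%:Z.
  rewrite coprimezMl [coprimez 2 _]coprimezE /= coprime2n p_odd /=.
  rewrite coprimez_sym coprimezE /= prime_coprime // -[p]/(absz p%:Z) -dvdzE.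
  apply/negP => px; have : (p%:Z %| r%:Z)%Z.
    rewrite -(subrK (x ^+ 2) r%:Z) rpredD //; last by rewrite expr2 dvdz_mulr.
    by apply: dvdz_trans xr; rewrite expnS PoszM dvdz_mulr.
  by rewrite dvdzE /= -legendre_eq0 // r1.
have [[u v] /= uv] := coprimezP _ _ copx.
exists (x + c * u * (p ^ e.+1)%:Z).
have -> : r%:Z - (x + c * u * (p ^ e.+1)%:Z) ^+ 2 =
   (p ^ e.+1)%:Z * (c * (1 - u * (2 * x)) - (c * u) ^+ 2 * (p ^ e.+1)%:Z).
  rewrite -(subrK (x ^+ 2) r%:Z) cE; ring.
rewrite (expnSr p e.+1) PoszM dvdz_mul //.
have -> : 1 - u * (2 * x) = v * p%:Z by apply/eqP; rewrite subr_eq addrC uv.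
rewrite rpredB //; first by rewrite mulrA dvdz_mull.
by rewrite expnS PoszM dvdz_mull // dvdz_mulr.
Qed.

(** The start is r = 1^2 mod 8. If r - x^2 = c 2^(h+2) with c odd, then x + 2^(h+1) works mod
    2^(h+3), because c - x is even and h >= 1. *)
Lemma hensel_two r e : (r %% 8 = 1)%N -> quadratic_residue (2 ^ e) r.
Proof.
move=> r8; have base f : (f <= 3)%N -> quadratic_residue (2 ^ f) r.
  move=> f3; apply/quadratic_residueP; exists 1; rewrite expr1n.
  apply: (@dvdz_trans 8); first by rewrite dvdzE /= (@dvdn_exp2l 2 f 3).
  by rewrite -eqz_mod_dvd !modz_nat r8.
have [e3|/ltnW e3] := leqP e 3; first exact: base.
rewrite -(subnK e3); elim: (e - 3)%N => [|f]; first exact: base.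
rewrite addSn; move: (f + 3)%N (leq_addl f 3) => {e3 f} [|[|h]] // h_gt0.
case/quadratic_residueP => x xr; apply/quadratic_residueP.
have [c cE] := dvdzP xr.
have r_odd : odd r by lia.
have x_odd : odd `|x|.
  apply: contraT => x_even; have : (2 %| r%:Z)%Z.
    rewrite -(subrK (x ^+ 2) r%:Z) rpredD //; last by rewrite expr2 dvdz_mulr // dvdzE /= dvdn2.
    by apply: dvdz_trans xr; rewrite expnS PoszM dvdz_mulr.
  by rewrite dvdzE /= dvdn2 r_odd.
have [c_odd|c_even] := boolP (odd `|c|); last first.
  by exists x; rewrite cE (expnS 2 h.+2) PoszM dvdz_mul // dvdzE /= dvdn2.
exists (x + (2 ^ h.+1)%:Z).
have -> : r%:Z - (x + (2 ^ h.+1)%:Z) ^+ 2 = (2 ^ h.+2)%:Z * (c - x - (2 ^ h)%:Z).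
  rewrite -(subrK (x ^+ 2) r%:Z) cE !expnS !PoszM; ring.
rewrite (expnSr 2 h.+2) PoszM dvdz_mul // rpredB //; last first.
  by case: h h_gt0 {cE xr} => // h _; rewrite expnS PoszM dvdz_mulr.
have mod2 (y : int) : odd `|y| -> (y %% 2)%Z = 1.
  move=> y_odd; have : (y %% 2)%Z != 0.
    by apply/eqP => /dvdz_mod0P; rewrite dvdzE /= dvdn2 y_odd.
  by have := @modz_ge0 y 2 isT; have := @ltz_pmod y 2 isT; lia.
by rewrite -eqz_mod_dvd !mod2.
Qed.

Lemma quadratic_residue_local n r : (0 < n)%N -> (r %% 8 = 1)%N ->
  (forall p, p \in primes n -> odd p -> legendre p r = 1) -> quadratic_residue n r.
Proof.
move=> n_gt0 r8; elim/ltn_ind: n n_gt0 => n IH n_gt0 leg; have [n1|n_gt1] := leqP n 1.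
  have -> : n = (2 ^ 0)%N by lia.
  exact: hensel_two.
have p_pr := pdiv_prime n_gt1; set p := pdiv n in p_pr.
have [m cop_pm nE] := pfactor_coprime p_pr n_gt0.
have m_gt0 : (0 < m)%N by move: n_gt0; rewrite nE muln_gt0 => /andP[].
have p_n : p \in primes n by rewrite mem_primes p_pr n_gt0 pdiv_dvd.
have l_gt0 : (0 < logn p n)%N by rewrite logn_gt0.
have lt_mn : (m < n)%N.
  by rewrite nE -{1}[m]muln1 ltn_pmul2l // -(expn0 p) ltn_exp2l ?prime_gt1.
rewrite nE mulnC; apply: quadratic_residue_mul; first by rewrite coprimeXl.
  have [p2|p_odd] := even_prime p_pr; first by rewrite p2; exact: hensel_two.
  by apply: hensel_odd => //; exact: leg.
apply: IH => // q; rewrite mem_primes => /and3P[q_pr _ q_m] q_odd.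
by apply: leg; rewrite // mem_primes q_pr n_gt0 nE dvdn_mulr.
Qed.

Lemma pigeonhole (T : eqType) (K : finType) (f : T -> K) (s : seq T) : uniq s ->
  (#|K| < size s)%N -> exists x y, [/\ x \in s, y \in s, x != y & f x = f y].
Proof.
move=> s_uniq lt_K; apply: contrapT => no.
have inj : {in s &, injective f}.
  move=> x y xs ys fxy; apply/eqP; apply: contraT => xy.
  by case: no; exists x, y.
have := max_card (mem (map f s)); rewrite (card_uniqP _) ?map_inj_in_uniq // size_map.
by rewrite leqNgt lt_K.
Qed.

Lemma ell_upper_bound n : (0 < n)%N -> (0 < num_odd_primes n)%N ->
  (ell n <= 2 ^ 14 * num_odd_primes n ^ 2 * 4 ^ num_odd_primes n)%N.
Proof.
move=> n_gt0; set k := num_odd_primes n => k_gt0.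
pose odds := [seq p <- primes n | odd p].
have sz_odds : size odds = k by rewrite size_filter.
(* Now 2^d = 128 * 2^t * 2^k and d <= 8 * 2^t, so there are at least 16 * 2^k - 1 primes up to 2^d,
   and more than 8 * 2^k remain after removing 2 and the k odd primes of n. As 2^t <= k, 2^(2d) is
   at most the bound claimed. *)
pose t := trunc_log 2 k; pose d := (k + t + 7)%N.
have T_gt0 : (0 < 2 ^ t)%N by rewrite expn_gt0.
have Tk : (2 ^ t <= k)%N by apply: trunc_logP.
have kT : (k < 2 * 2 ^ t)%N by rewrite -expnS trunc_log_ltn.
pose B := [seq p <- [seq p <- iota 0 (2 ^ d).+1 | prime p] | p \notin 2%N :: odds].
have memB p : p \in B -> [/\ prime p, (p <= 2 ^ d)%N, p != 2%N & p \notin odds].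
  rewrite mem_filter in_cons negb_or => /andP[/andP[p2 p_odds]].
  by rewrite mem_filter mem_iota => /and3P[p_pr _ p_le]; split.
have szB : (8 * 2 ^ k < size B)%N.
  have le_pi : (prime_pi (2 ^ d) <= size B + k.+1)%N.
    rewrite -sz_odds -[(size odds).+1]/(size (2%N :: odds)) -size_cat /prime_pi -size_filter.
    apply: uniq_leq_size; first by rewrite filter_uniq ?iota_uniq.
    by move=> p pA; rewrite mem_cat mem_filter pA andbT orNb.
  have d_gt0 : (0 < d)%N by rewrite /d addnS.
  have := prime_pi_lb d_gt0; have dT : (d <= 8 * 2 ^ t)%N.
    have := ltn_expl t (isT : 1 < 2)%N; rewrite /d; lia.
  have d2 : (2 ^ d = 2 ^ t * (128 * 2 ^ k))%N 
    by rewrite /d !expnD mulnAC [RHS]mulnC [(128 * _)%N]mulnC.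
  rewrite {1}d2 ltnNge => le_d; apply/negP => le_B.
  have : (2 ^ t * (128 * 2 ^ k) <= 8 * 2 ^ t * (8 * 2 ^ k + k.+2))%N.
    apply: leq_trans le_d _; apply: leq_mul => //; rewrite addnS ltnS.
    by apply: leq_trans le_pi _; rewrite leq_add2r.
  rewrite [(8 * 2 ^ t)%N]mulnC -mulnA leq_pmul2l //.
  by have := ltn_expl k (isT : 1 < 2)%N; lia.
pose key a : 'I_8 * {ffun 'I_k -> bool} :=
  (Ordinal (ltn_pmod a (isT : 0 < 8)%N), [ffun i : 'I_k => legendre (nth 0%N odds i) a == 1]).
have cardK : #|{: 'I_8 * {ffun 'I_k -> bool}}| = (8 * 2 ^ k)%N.
  by rewrite card_prod card_ord card_ffun card_bool card_ord.
have B_uniq : uniq B by rewrite !filter_uniq ?iota_uniq.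
have [a [b [/memB[a_pr a_le a2 a_odds] /memB[b_pr b_le b2 b_odds] ab key_ab]]] :
    exists a b, [/\ a \in B, b \in B, a != b & key a = key b].
  by apply: pigeonhole => //; rewrite cardK.
have cop p : prime p -> p != 2%N -> p \notin odds -> coprime p n.
  move=> p_pr p2; rewrite mem_filter prime_coprime // mem_primes p_pr n_gt0 /=.
  by case: (even_prime p_pr) p2 => [->|->].
apply: (@leq_trans (a * b)).
  apply: ell_le_nonsquare => // [e abE||].
  - have a_e : (a %| e)%N.
      have : (a %| e ^ 2)%N by rewrite -abE dvdn_mulr.
      by rewrite Euclid_dvdX // => /andP[].
    have : (a * a %| a * b)%N by rewrite abE mulnn dvdn_exp2r.
    by rewrite dvdn_pmul2l ?prime_gt0 // dvdn_prime2 // (negPf ab).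
  - by rewrite coprimeMl !cop.
  apply: quadratic_residue_local => //.
    have /(congr1 val) /= ab8 : Ordinal (ltn_pmod a (isT : 0 < 8)%N) = Ordinal (ltn_pmod b (isT : 0 < 8)%N).
      by case: key_ab => e _; apply: val_inj.
    have b_odd : odd b by case: (even_prime b_pr) b2 => [->|].
    rewrite -modnMml ab8 modnMml -modnMml -modnMmr.
    have : odd (b %% 8) by rewrite odd_mod.
    have := ltn_pmod b (isT : 0 < 8)%N.
    by move: (b %% 8)%N; do 8?[case=> [|]//].
  move=> p p_n p_odd; have p_odds : p \in odds by rewrite mem_filter p_odd.
  have p_pr : prime p by move: p_n; rewrite mem_primes => /andP[].
  have i_lt : (index p odds < k)%N by rewrite -sz_odds index_mem.
  have /ffunP /(_ (Ordinal i_lt)) : (key a).2 = (key b).2 by rewrite key_ab.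
  rewrite !ffunE /= nth_index // legendreM //.
  have leg_sign q : prime q -> q \notin odds -> legendre p q = 1 \/ legendre p q = -1.
    move=> q_pr q_odds; apply: qchar_neq0.
    rewrite -(dvdn_pcharf (pchar_Fp p_pr)) dvdn_prime2 //.
    by apply: contraNneq q_odds => <-.
  by case: (leg_sign a) => // ->; case: (leg_sign b) => // ->.
apply: (leq_trans (leq_mul a_le b_le)).
have -> : (2 ^ d * 2 ^ d = 2 ^ 14 * (2 ^ t) ^ 2 * 4 ^ k)%N.
  have -> : (4 ^ k = 2 ^ k * 2 ^ k)%N by rewrite -expnMn.
  by rewrite /d !expnD -[14%N]/(7 + 7)%N expnD; move: (2 ^ 7)%N => x; ring.
by rewrite leq_mul2r leq_mul2l leq_exp2r // Tk !orbT.
Qed.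
End UpperBound.

(** * The lower bound *)

Section SquarefreeNumbers.
Local Open Scope nat_scope.

(** In an increasing list above m the i-th entry is at least m + i. *)
Lemma fact_le_prod (s : seq nat) m : path ltn m s -> (m + size s)`! <= m`! * \prod_(x <- s) x.
Proof.
elim: s m => [|x s IH] m /=; first by rewrite addn0 big_nil muln1.
move=> /andP[mx xs]; rewrite big_cons addnS -addSn.
have m1s : path ltn m.+1 s.
  move: mx; rewrite leq_eqVlt => /orP[/eqP->//|mx]; apply: path_le xs => //.
  exact: ltn_trans.
apply: leq_trans (IH _ m1s) _; rewrite factS [m.+1 * _]mulnC -mulnA.
by rewrite leq_mul2l leq_mul2r mx !orbT.
Qed.

Lemma squarefree_prod_primes r : 0 < r -> squarefree r -> \prod_(p <- primes r) p = r.
Proof.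
move=> r_gt0 sqf; rewrite [RHS]prod_prime_decomp // prime_decompE big_map /=.
rewrite big_seq [RHS]big_seq; apply: eq_bigr => p p_r.
suff -> : logn p r = 1 by rewrite expn1.
have l_gt0 : 0 < logn p r by rewrite logn_gt0.
have p_pr : prime p by move: p_r; rewrite mem_primes => /andP[].
apply/eqP; rewrite eqn_leq l_gt0 andbT leqNgt; apply/negP => l2.
have := sqf p; rewrite pfactor_dvdn // => /(_ l2) p1.
by rewrite p1 in p_pr.
Qed.

Lemma squarefree_fact_size_primes r : 0 < r -> squarefree r -> (size (primes r))`! <= r.
Proof.
move=> r_gt0 sqf; rewrite -{2}(squarefree_prod_primes r_gt0 sqf).
have := @fact_le_prod (primes r) 0; rewrite add0n mul1n; apply.
have := sorted_primes r; case E : (primes r) => [|p s] //= ->; rewrite andbT.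
by apply: prime_gt0; have : p \in primes r; [rewrite E mem_head|rewrite mem_primes => /andP[]].
Qed.

End SquarefreeNumbers.

Section LowerBound.
Variable R : realType.

Lemma exists_prime_family X N (e : nat -> nat -> int) k :
  (forall i q, e i q \in [:: 1; -1]) ->
  exists s : seq nat, [/\ size s = k, uniq s,
    (forall p, p \in s -> prime p /\ (N < p)%N /\ odd p) &
    forall i q, (i < k)%N -> prime q -> (q < X)%N -> legendre (nth 0%N s i) q = e i q].
Proof.
move=> e_sign; elim: k => [|k [s [sz s_uniq sP s_leg]]]; first by exists [::].
(* Exceeding the sum of the earlier primes makes p different from each of them. *)
have [p [p_pr p_gt p4 p_leg]] := exists_prime_legendre R X (N + \sum_(q <- s) q)%N (e_sign k).
have p_s : p \notin s.
  apply/negP => ps; have : (p <= \sum_(q <- s) q)%N by rewrite (big_rem p) //= leq_addr.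
  by move: p_gt; lia.
exists (rcons s p); split.
- by rewrite size_rcons sz.
- by rewrite rcons_uniq p_s.
- move=> q; rewrite mem_rcons in_cons => /orP[/eqP->|/sP//].
  by split=> //; split; [lia|exact: modn4_odd].
move=> i q; rewrite ltnS leq_eqVlt nth_rcons sz => /orP[/eqP->|ik] q_pr qX.
  by rewrite ltnn eqxx p_leg.
by rewrite ik s_leg.
Qed.

Lemma prod_sign_F2 (T : Type) (t : seq T) (c : T -> 'F_2) :
  \prod_(q <- t) (if c q == 0 then 1 else -1 : int) =
  if \sum_(q <- t) c q == 0 then 1 else -1.
Proof.
elim: t => [|q t IH]; first by rewrite !big_nil.
rewrite !big_cons IH; case: (F2_case (c q)) => ->; first by rewrite add0r mul1r.
by case: (F2_case (\sum_(q <- t) c q)) => ->.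
Qed.

Lemma size_prod_le (P : nat -> {poly 'F_2}) (s : seq nat) C :
  (forall q, q \in s -> P q != 0 /\ (2 ^ (size (P q)).-1 <= C * q)%N) ->
  (2 ^ (size (\prod_(q <- s) P q)%R).-1 <= C ^ size s * \prod_(q <- s) q)%N.
Proof.
move=> sP; suff [] : (\prod_(q <- s) P q)%R != 0 /\
  (2 ^ (size (\prod_(q <- s) P q)%R).-1 <= C ^ size s * \prod_(q <- s) q)%N by [].
elim: s sP => [|q s IH] sP; first by rewrite !big_nil oner_eq0 size_poly1.
have [r r_in|r0 le_r] := IH; first by apply: sP; rewrite in_cons r_in orbT.
have [q0 le_q] := sP q (mem_head _ _); rewrite !big_cons mulf_neq0 //; split=> //.
rewrite size_mul // expnS mulnACA.
have -> : ((size (P q) + size (\prod_(j <- s) P j)%R).-1.-1 =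
   (size (P q)).-1 + (size (\prod_(j <- s) P j)%R).-1)%N.
  by move: q0 r0; rewrite -!size_poly_gt0; lia.
by rewrite expnD leq_mul.
Qed.

(** For q < 4^k the prime p_j gets (q/p_j) = -1 exactly when the j-th digit of P_q is 1. If r
    64^omega(r) < 4^k, the product of the P_q over q | r has degree below 2k, so some digit sum is
    nonzero and (r/p_j) = -1, whereas a residue has symbol 1 at each p_j. *)
Lemma exists_large_modulus k N : (0 < k)%N -> exists n, [/\ (N < n)%N, odd n, size (primes n) = k &
  forall r, squarefree_residue n r -> (4 ^ k <= r * 64 ^ size (primes r))%N].
Proof.
move=> k_gt0; have [lam lamP] := exists_log_derivative_digits k.
have [P [P_irr P_inj]] := prime_irreducible_injection k.*2.
(* Digits are indexed by ['I_k]; outside that range [c] takes the default 0, and only i < k is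
   evaluated. *)
pose c i q := if insub i is Some j then lam (P q) j else 0.
pose e i q : int := if c i q == 0 then 1 else -1.
have e_sign i q : e i q \in [:: 1; -1] by rewrite /e; case: ifP.
have [s [sz s_uniq sP s_leg]] := exists_prime_family (2 ^ k.*2) N k e_sign.
pose n := (\prod_(p <- s) p)%N.
have n_gt0 : (0 < n)%N.
  by rewrite /n big_seq prodn_cond_gt0 // => p /sP[/prime_gt0].
have dvd_n p : p \in s -> (p %| n)%N by move=> ps; rewrite /n (big_rem p) //= dvdn_mulr.
have primes_n : primes n =i s.
  move=> p; rewrite mem_primes n_gt0 /=; apply/andP/idP => [[p_pr]|ps]; last first.
    by split; [case: (sP p ps)|exact: dvd_n].
  rewrite /n; elim: (s) sP => [|q t IH] tP; first by rewrite big_nil Euclid_dvd1.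
  rewrite big_cons Euclid_dvdM // in_cons => /orP[|p_t].
    by rewrite dvdn_prime2 // => [->//|]; case: (tP q (mem_head _ _)).
  by rewrite IH ?orbT // => r rt; apply: tP; rewrite in_cons rt orbT.
exists n; split.
- have s0 : nth 0%N s 0 \in s by rewrite mem_nth // sz.
  by have [_ [lt_N _]] := sP _ s0; apply: leq_trans lt_N (dvdn_leq n_gt0 (dvd_n _ s0)).
- by rewrite /n big_seq; elim/big_ind: _ => // [x y ox oy|p /sP[_ []] //]; rewrite oddM ox.
- by rewrite -sz; apply/perm_size/uniq_perm; rewrite ?primes_uniq.
move=> r [r_gt1 sqf cop qr]; have r_gt0 := ltnW r_gt1; rewrite leqNgt; apply/negP => lt_r.
have r_lt : (r < 2 ^ k.*2)%N.
  rewrite -mul2n expnM; apply: leq_ltn_trans lt_r.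
  by rewrite -{1}[r]muln1 leq_mul2l expn_gt0 orbT.
have q_pr q : q \in primes r -> prime q by rewrite mem_primes => /andP[].
have q_lt q : q \in primes r -> (q < 2 ^ k.*2)%N.
  by rewrite mem_primes r_gt0 /= => /andP[_ /(dvdn_leq r_gt0)] /leq_ltn_trans; apply.
have q_irr q (qr_in : q \in primes r) := P_irr q (q_pr q qr_in) (q_lt q qr_in).
have [||||j] := lamP [seq P q | q <- primes r].
- rewrite map_inj_in_uniq ?primes_uniq // => q q' q_r q'_r.
  by apply: P_inj; rewrite ?q_pr ?q_lt.
- by case E : (primes r) => //; have := primes_eq0 r; rewrite E eqxx ltnNge r_gt1.
- by move=> _ /mapP[q q_r ->]; have [] := q_irr q q_r.
- rewrite big_map; have := @size_prod_le P (primes r) 64.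
  have hyp q : q \in primes r -> P q != 0 /\ (2 ^ (size (P q)).-1 <= 64 * q)%N.
    by move=> /q_irr[irr _ le_q]; split=> //; exact: irredp_neq0.
  move=> /(_ hyp); rewrite squarefree_prod_primes // mulnC => le_r.
  have := leq_ltn_trans le_r lt_r; rewrite -[4%N]/(2 ^ 2)%N -expnM mul2n ltn_exp2l //.
  by move: (size _) => x; lia.
rewrite big_map => /negP; apply; have jk := ltn_ord j.
have p_s : nth 0%N s j \in s by rewrite mem_nth // sz.
have [p_pr [_ p_odd]] := sP _ p_s.
have := legendre_residue p_pr p_odd (dvd_n _ p_s) cop qr.
have -> : legendre (nth 0%N s j) r = \prod_(q <- primes r) e j q.
  rewrite -{1}(squarefree_prod_primes r_gt0 sqf).
  rewrite (big_morph _ (legendreM p_pr p_odd) (legendre1 _)).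
  by rewrite big_seq [RHS]big_seq; apply: eq_bigr => q q_r; rewrite s_leg ?q_pr ?q_lt.
rewrite /e prod_sign_F2; case: eqP => // c0 _; apply/eqP; rewrite -[RHS]c0; apply: eq_bigr => q _.
by rewrite /c valK.
Qed.
End LowerBound.

(** * The bound omega(r) = O(k / log k) *)

Section FactorialGrowth.
Variable R : realType.
Notation lnn n := (ln (n%:R : R)).

Lemma ln_fact_ge w : w%:R * lnn w - w%:R <= lnn w`!.
Proof.
elim: w => [|w IH]; first by rewrite fact0 ln1 mul0r subrr.
have [->|w_gt0] := posnP w; first by rewrite factS fact0 muln1 ln1 mulr0; lra.
have w0 : 0 < w%:R :> R by rewrite ltr0n.
rewrite factS natrM lnM ?posrE ?ltr0n ?fact_gt0 //.
have e := lnn_succ_le R w_gt0.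
move: e IH; set l1 := lnn w.+1; rewrite -natr1; lra.
Qed.

(** If w^2 <= k, split ln k = ln(k/w) + ln w and use ln x < x to get 2k. Otherwise ln k <= 2 ln w,
    and w ln w <= ln w! + w <= 2k + 3k, which doubles to 10k. *)
Lemma mul_ln_le_of_fact_le k w : (2 <= k)%N -> (w`! <= 4 ^ k)%N ->
  w%:R * lnn k <= 10 * k%:R.
Proof.
move=> k2 fact_le; have k_gt0 : (0 < k)%N by apply: leq_trans k2.
have kR : 0 < k%:R :> R by rewrite ltr0n.
have [->|w_gt0] := posnP w; first by rewrite mul0r mulr_ge0 // ltW.
have wR : 0 < w%:R :> R by rewrite ltr0n.
have [ww_k|k_ww] := leqP (w * w) k.
  have lnkw : lnn k = ln (k%:R / w%:R) + lnn w.
    by rewrite ln_div ?posrE // subrK.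
  have le1 : w%:R * ln (k%:R / w%:R) <= k%:R :> R.
    have := ltW (ln_sublinear (divr_gt0 kR wR)); rewrite -(ler_pM2l wR) => /le_trans; apply.
    by rewrite mulrCA divff ?mulr1 // lt0r_neq0.
  have le2 : w%:R * lnn w <= k%:R.
    have := ltW (ln_sublinear wR); rewrite -(ler_pM2l wR) => /le_trans; apply.
    by rewrite -natrM ler_nat.
  by rewrite lnkw mulrDr; lra.
have lnk : lnn k <= 2 * lnn w.
  have -> : 2 * lnn w = lnn (w * w)%N by rewrite natrM lnM ?posrE //; ring.
  by rewrite ler_ln ?posrE ?ltr0n ?muln_gt0 ?w_gt0 // ler_nat ltnW.
have ln2 := lnn2_le1 R.
have ln_fact_le : lnn w`! <= 2 * k%:R.
  apply: (@le_trans _ _ (lnn (4 ^ k)%N)).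
    by rewrite ler_ln ?posrE ?ltr0n ?fact_gt0 ?expn_gt0 // ler_nat.
  have ln4 : lnn 4 = lnn 2 + lnn 2 by rewrite -lnM ?posrE // -natrM.
  by rewrite natrX lnXn // -[leLHS]mulr_natr ler_wpM2r ?(ltW kR) // ln4; lra.
have w_le : w%:R <= 3 * k%:R :> R.
  have pow_le m : (2 ^ m <= m.+1`!)%N.
    by elim: m => // m IH; rewrite expnS factS leq_mul.
  have : (2 ^ w.-1 <= 2 ^ (2 * k))%N.
    by apply: leq_trans (pow_le _) _; rewrite prednK // expnM.
  by rewrite leq_exp2l // -natrM ler_nat; lia.
by have := ln_fact_ge w; have := ler_wpM2l (ltW wR) lnk; lra.
Qed.
End FactorialGrowth.

(** * Assembly of the two bounds *)

Theorem theorem1p1 (R : realType) :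
  (exists C : R, forall n : nat, (0 < n)%N -> (0 < num_odd_primes n)%N ->
     (ell n)%:R <= C * (num_odd_primes n)%:R ^+ 2 * 4 ^+ num_odd_primes n)
  /\
  (exists C : R, forall k : nat, (2 <= k)%N ->
     infinite_set [set n : nat | [/\ odd n, size (primes n) = k &
       4 `^ (k%:R - C * k%:R / ln k%:R) <= (ell n)%:R :> R]]).
Proof.
split.
  exists (2 ^ 14)%N%:R => n n_gt0 k_gt0.
  by rewrite -!natrX -!natrM ler_nat ell_upper_bound.
(* The factor 64^w is 4^(3w), and w ln k <= 10 k bounds 3w by 30 k / ln k. *)
exists 30 => k k2; have k_gt0 : (0 < k)%N by apply: leq_trans k2.
have lnk_gt0 : 0 < ln k%:R :> R by rewrite ln_gt0 // ltr1n.
set A := [set n | _] => /finite_seqP[s sE].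
(* An n above the sum of the finite list [s] cannot belong to it. *)
have [n [n_gt n_odd sz_n large]] := exists_large_modulus R (\sum_(i <- s) i)%N k_gt0.
suff nA : A n.
  move: nA; rewrite sE /= => ns.
  by move: n_gt; rewrite (big_rem n) //= ltnNge leq_addr.
split=> //; have n_gt0 : (0 < n)%N by apply: leq_ltn_trans n_gt.
have [ell_res _] := ellP n_gt0; have := large _ ell_res.
have [r_gt1 sqf _ _] := ell_res; move: (ell n) r_gt1 sqf => r r_gt1 sqf {ell_res large}.
have r_gt0 := ltnW r_gt1; set w := size (primes r) => le_r.
have kx_ge0 : 0 <= 30 * k%:R / ln k%:R :> R by rewrite !mulr_ge0 // invr_ge0 ltW.
(* For r >= 4^k the bound is immediate; otherwise w! <= r < 4^k makes w small. *)
have [r_ge|r_lt] := leqP (4 ^ k) r.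
  apply: (@le_trans _ _ (4 `^ k%:R)); first by rewrite ler_powR; lra.
  by rewrite powR_mulrn // -natrX ler_nat.
have w_le : w%:R * ln k%:R <= 10 * k%:R :> R.
  apply: mul_ln_le_of_fact_le => //; apply: leq_trans (ltnW r_lt).
  exact: squarefree_fact_size_primes.
have w_le' : (3 * w)%:R <= 30 * k%:R / ln k%:R :> R.
  by rewrite ler_pdivlMr // natrM; lra.
rewrite powRB ?implybT; last by apply/implyP => _; rewrite pnatr_eq0.
rewrite ler_pdivrMr ?powR_gt0 // powR_mulrn //.
apply: (@le_trans _ _ (r%:R * 4 `^ (3 * w)%:R)); last first.
  by rewrite ler_wpM2l // ler_powR // ler1n.
by rewrite powR_mulrn // exprM -!natrX -natrM ler_nat.
Qed.
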